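(* For a solid partition $\pi$ and a choice of sign of $\mathsf{w}_\pi$, consider the following properties, where $d$ is a formal variable and $\lambda_4=-(\lambda_1+\lambda_2+\lambda_3)$: (a) $L_\pi(0,0,0,-d)\,\mathsf{w}_\pi$ has no pole along $\lambda_1+\lambda_2+\lambda_3=0$. (b) The specialization $L_\pi(0,0,0,-d)\,\mathsf{w}_\pi\big|_{\lambda_1+\lambda_2+\lambda_3=0}$ is independent of $\lambda_1,\lambda_2,\lambda_3$. (c) There exists a rational number $\omega_\pi\in\mathbb{Q}_{>0}$, independent of $d$, such that $$L_\pi(0,0,0,-d)\,\mathsf{w}_\pi\big|_{\lambda_1+\lambda_2+\lambda_3=0}=(-1)^{|\pi|}\,\omega_\pi\prod_{l=1}^{\pi_{111}}(d-(l-1)).$$ Then: (1) (a), (b), (c) hold for every solid partition $\pi$ of size $|\pi|\leqslant6$, where the signs of $(\mathsf{w}_\pi)_{|\pi|\leqslant 6}$ are the unique ones for which $$\sum_{\pi} L_\pi(d_1,d_2,d_3,d_4)\,\mathsf{w}_\pi\,q^{|\pi|}\equiv M(-q)^{\frac{(d_1\lambda_1+d_2\lambda_2+d_3\lambda_3+d_4\lambda_4)(-\lambda_1\lambda_2\lambda_3-\lambda_1\lambda_2\lambda_4-\lambda_1\lambda_3\lambda_4-\lambda_2\lambda_3\lambda_4)}{\lambda_1\lambda_2\lambda_3\lambda_4}}\pmod{q^7}.$$ (2) For $d=1$ and every solid partition $\pi$ with $\pi_{111}=1$, (a), (b) and (c) up to an overall sign hold, with $|\omega_\pi|=1$; that is,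 $L_\pi(0,0,0,-1)\,\mathsf{w}_\pi$ has no pole along $\lambda_1+\lambda_2+\lambda_3=0$ and its specialization there equals $\pm1$. (3) (a), (b), and (c) up to an overall sign hold for each of the following solid partitions $\pi$: all $\pi$ with $\pi_{ijk}=0$ unless $i=j=1$ and $|\pi|\leqslant10$; and the solid partitions with $Z_\pi$ equal to each of size 7: $1+t_1+t_2+t_1t_2+t_3+t_4+t_4^2$; size 8: $1+t_1+t_2+t_1t_2+t_3+t_4+t_1t_4+t_4^2$; size 9: $1+t_1+t_1^2+t_2+t_1t_2+t_3+t_4+t_1t_4+t_4^2$; size 10: $1+t_1+t_1^2+t_2+t_1t_2+t_2t_3+t_3+t_4+t_1t_4+t_4^2$; size 11: $1+t_1+t_1^2+t_2+t_1t_2+t_2t_3+t_3+t_4+t_1t_4+t_2t_4+t_4^2$; size 12: $1+t_1+t_1^2+t_2+t_1t_2+t_2t_3+t_3+t_4+t_1t_4+t_2t_4+t_4^2+t_4^3$; size 13: $1+t_1+t_1^2+t_2+t_1t_2+t_2t_3+t_3+t_4+t_1t_4+t_2t_4+t_4^2+t_4^3+t_4^4$; size 14: $1+t_1+t_1^2+t_2+t_1t_2+t_2t_3+t_3+t_4+t_1t_4+t_2t_4+t_4^2+t_4^3+t_4^4+t_4^5$; size 15: $1+t_1+t_1^2+t_2+t_2^2+t_1t_2+t_2t_3+t_3+t_4+t_1t_4+t_2t_4+t_4^2+t_4^3+t_4^4+t_4^5$.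
   Context: A solid partition $\pi=\{\pi_{ijk}\}_{i,j,k\geqslant1}$ is a sequence of non-negative integers with $\pi_{ijk}\geqslant\pi_{i+1,j,k}$, $\pi_{ijk}\geqslant\pi_{i,j+1,k}$, $\pi_{ijk}\geqslant\pi_{i,j,k+1}$ for all $i,j,k\geqslant1$ and finite size $|\pi|:=\sum\pi_{ijk}<\infty$. Put $$Z_\pi=\sum_{i,j,k\geqslant1}\sum_{l=1}^{\pi_{ijk}}t_1^{i-1}t_2^{j-1}t_3^{k-1}t_4^{l-1},$$ and let $\overline{(\cdot)}$ be the involution on Laurent polynomials with $t_i\mapsto t_i^{-1}$. Define $$\mathsf{V}_\pi:=Z_\pi+\frac{\overline{Z}_\pi}{t_1t_2t_3t_4}-\frac{Z_\pi\overline{Z}_\pi(1-t_1)(1-t_2)(1-t_3)(1-t_4)}{t_1t_2t_3t_4}.$$ $K=\mathbb{Q}(\lambda_1,\lambda_2,\lambda_3,\lambda_4)/(\lambda_1+\lambda_2+\lambda_3+\lambda_4)$ denotes the field $\mathbb{Q}(\lambda_1,\lambda_2,\lambda_3)$ with $\lambda_4:=-(\lambda_1+\lambda_2+\lambda_3)$. After specializing $t_1t_2t_3t_4=1$ (i.e. identifying $t^w$ and $t^{w'}$ when $w-w'\in\mathbb{Z}(1,1,1,1)$), write $\mathsf{V}_\pi=\sum_w c_w t^w$, $w\in\mathbb{Z}^4/\mathbb{Z}(1,1,1,1)$, and set $e_T(-\mathsf{V}_\pi):=\prod_w(w_1\lambda_1+w_2\lambda_2+w_3\lambda_3+w_4\lambda_4)^{-c_w}\in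 K$; the coefficient $c_0$ of the trivial weight is $\leqslant0$, with the conventions $0^0=1$ and $e_T(-\mathsf V_\pi)=0$ if $c_0<0$. The element $(-1)^{|\pi|}e_T(-\mathsf{V}_\pi)$ is a square in $K$, and $\mathsf{w}_\pi:=\pm\sqrt{(-1)^{|\pi|}e_T(-\mathsf{V}_\pi)}\in K$ is defined up to sign. Finally $$L_\pi(d_1,d_2,d_3,d_4):=\prod_{i,j,k\geqslant1}\prod_{l=1}^{\pi_{ijk}}\big((d_1+i-1)\lambda_1+(d_2+j-1)\lambda_2+(d_3+k-1)\lambda_3+(d_4+l-1)\lambda_4\big).$$ $M(q)=\prod_{n\geqslant1}(1-q^n)^{-n}$ is the MacMahon function and $M(-q)^a:=\exp(a\log M(-q))$. The existence and uniqueness of the signs referred to in (1) (for $|\pi|\leqslant6$, with the identity in $K(d_1,d_2,d_3,d_4)[\![q]\!]$) is a known fact. ''(c) up to an overall sign'' means that the equation in (c) holds after replacing its right-hand side by plus or minus itself, for some $\omega_\pi\in\mathbb{Q}_{>0}$. *)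

(* Defs.v *)
(* MathComp, multinomials (mpoly, freeg), finmap, and the classical layer of
   MathComp-Analysis for finitely supported sums over a set. *)
From HB Require Import structures.
From mathcomp Require Import all_boot all_order all_algebra fraction finmap.
From mathcomp Require Import mpoly freeg.
From mathcomp Require Import boolp classical_sets fsbigop.

Set Implicit Arguments.
Unset Strict Implicit.
Unset Printing Implicit Defensive.

Import Order.TTheory GRing.Theory Num.Theory.
Local Open Scope classical_set_scope.
Local Open Scope ring_scope.

Local Notation "x %:F" := (tofrac x).

(** * Solid partitions *)

(* All indices are shifted to start at 0: pi (i, j, k) is $\pi_{i+1,j+1,k+1}$. *)
Definition array3 := {fsfun nat * nat * nat -> nat with 0%N}.

Definition solid (pi : array3) : Prop := forall i j k : nat,
  [/\ (pi (i.+1, j, k) <= pi (i, j, k))%N,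
      (pi (i, j.+1, k) <= pi (i, j, k))%N
    & (pi (i, j, k.+1) <= pi (i, j, k))%N].

Definition psize (pi : array3) : nat := (\sum_(b <- finsupp pi) pi b)%N.

(* Exponent of the l-th box (l from 0) over position b. *)
Definition box (b : nat * nat * nat) (l : nat) : 4.-tuple nat :=
  [tuple b.1.1; b.1.2; b.2; l].

(** * Laurent polynomials in t1, t2, t3, t4 *)

(* The group ring of Z^4 over the integers, on the free abelian group of
   weights. *)
Definition weight := 'rV[int]_4.
Definition laurent := {freeg weight / int}.
HB.instance Definition _ := GRing.Zmodule.on laurent.

Definition mono (w : weight) : laurent := << w >>.
Definition lmul (f g : laurent) : laurent :=
  \sum_(u <- dom f) \sum_(v <- dom g) << coeff u f * coeff v g *g u + v >>.
Definition lbar (f : laurent) : laurent :=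
  \sum_(u <- dom f) << coeff u f *g - u >>.

Lemma sum_dom (M : zmodType) (h : weight -> int -> M) (r : seq weight)
    (f : laurent) :
  (forall u, h u 0 = 0) -> uniq r -> {subset dom f <= r} ->
  \sum_(u <- dom f) h u (coeff u f) = \sum_(u <- r) h u (coeff u f).
Proof.
move=> h0 ur sr; rewrite [RHS](bigID (mem (dom f))) /= [X in _ + X]big1 ?addr0.
  rewrite -[RHS]big_filter; apply: perm_big; apply: uniq_perm; rewrite ?uniq_dom ?filter_uniq //.
  by move=> u; rewrite mem_filter /=; case: (boolP (u \in dom f)) => // /sr ->.
by move=> u /coeff_outdom ->.
Qed.

Lemma sum_domD (M : zmodType) (h : weight -> int -> M) (f g : laurent) :
  (forall u, {morph h u : a b / a + b}) ->
  \sum_(u <- dom (f + g)) h u (coeff u (f + g))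
  = \sum_(u <- dom f) h u (coeff u f) + \sum_(u <- dom g) h u (coeff u g).
Proof.
move=> hD; have h0 u : h u 0 = 0.
  by apply: (addrI (h u 0)); rewrite -hD !addr0.
pose r := undup (dom (f + g) ++ dom f ++ dom g).
have ur : uniq r by exact: undup_uniq.
have sr k : k \in dom (f + g) ++ dom f ++ dom g -> k \in r by rewrite mem_undup.
rewrite !(@sum_dom _ h r) //; last first.
- by move=> u uf; apply: sr; rewrite !mem_cat uf.
- by move=> u uf; apply: sr; rewrite !mem_cat uf orbT.
- by move=> u uf; apply: sr; rewrite !mem_cat uf !orbT.
by rewrite -big_split; apply: eq_bigr => u _; rewrite coeffD hD.
Qed.

Lemma sum_domU (M : zmodType) (h : weight -> int -> M) (a : int) (w : weight) :
  (forall u, h u 0 = 0) ->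
  \sum_(u <- dom (<< a *g w >> : laurent)) h u (coeff u << a *g w >>) = h w a.
Proof.
move=> h0; rewrite (@sum_dom _ h [:: w]) //.
  by rewrite big_seq1 coeffU eqxx mulr1.
by move=> u; rewrite mem_dom coeffU inE (eq_sym u); case: (w == u) => //; rewrite mulr0 eqxx.
Qed.

Lemma lmulDl : left_distributive lmul +%R.
Proof.
move=> f g k; pose h u a : laurent :=
  \sum_(v <- dom k) << a * coeff v k *g u + v >>.
apply: (@sum_domD _ h) => u a b; rewrite -big_split; apply: eq_bigr => v _ /=.
by rewrite freegUD mulrDl.
Qed.

Lemma lmulC : commutative lmul.
Proof.
move=> f g; rewrite /lmul exchange_big; apply: eq_bigr => v _.
by apply: eq_bigr => u _; rewrite mulrC addrC.
Qed.

Lemma lmulDr : right_distributive lmul +%R.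
Proof. by move=> f g k; rewrite ![lmul f _]lmulC lmulDl. Qed.

Lemma lmulUU (a b : int) (u v : weight) :
  lmul << a *g u >> << b *g v >> = << a * b *g u + v >>.
Proof.
rewrite /lmul (@sum_domU _ (fun u a =>
  \sum_(v0 <- dom (<< b *g v >> : laurent)) << a * coeff v0 << b *g v >> *g u + v0 >>)).
  rewrite (@sum_domU _ (fun v b => << a * b *g u + v >>)) // => v0.
  by rewrite mulr0 freegU0.
by move=> u0; apply: big1 => v0 _; rewrite mul0r freegU0.
Qed.

Lemma lmul0l f : lmul 0 f = 0.
Proof. by apply: (addrI (lmul 0 f)); rewrite -lmulDl !addr0. Qed.

Lemma lmul0r f : lmul f 0 = 0.
Proof. by rewrite lmulC lmul0l. Qed.

Lemma lmulA : associative lmul.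
Proof.
move=> f g k; elim/freeg_ind_dom0: f => [|a u f _ _ IHf]; first by rewrite !lmul0l.
rewrite !lmulDl IHf; congr (_ + _) => {f IHf}.
elim/freeg_ind_dom0: g => [|b v g _ _ IHg]; first by rewrite !(lmul0l, lmul0r).
rewrite !(lmulDl, lmulDr) IHg; congr (_ + _) => {g IHg}.
elim/freeg_ind_dom0: k => [|c w k _ _ IHk]; first by rewrite !lmul0r.
by rewrite !lmulDr IHk !lmulUU mulrA addrA.
Qed.

Lemma lmul1l : left_id (mono 0) lmul.
Proof.
move=> f; elim/freeg_ind_dom0: f => [|a u f _ _ IHf]; first by rewrite lmul0r.
by rewrite lmulDr IHf lmulUU mul1r add0r.
Qed.

Lemma lone_neq0 : mono 0 != 0.
Proof. by rewrite freegU_eq0 oner_eq0. Qed.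

HB.instance Definition _ := GRing.Zmodule_isComNzRing.Build laurent
  lmulA lmulC lmul1l lmulDl lone_neq0.

Definition t1 : laurent := mono (delta_mx 0 (inord 0)).
Definition t2 : laurent := mono (delta_mx 0 (inord 1)).
Definition t3 : laurent := mono (delta_mx 0 (inord 2)).
Definition t4 : laurent := mono (delta_mx 0 (inord 3)).
(* $(t_1t_2t_3t_4)^{-1}$ *)
Definition tinv : laurent := mono (const_mx (-1)).

Definition Zchar (pi : array3) : laurent :=
  \sum_(b <- finsupp pi) \sum_(l < pi b)
     mono (\row_(i < 4) (tnth (box b l) i)%:Z).

Definition Vchar (pi : array3) : laurent :=
  let Z := Zchar pi in
  Z + lbar Z * tinv
  - Z * lbar Z * (1 - t1) * (1 - t2) * (1 - t3) * (1 - t4) * tinv.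

(* The specialization t1 t2 t3 t4 = 1: every weight is replaced by the
   representative with last coordinate 0 of its class modulo Z(1,1,1,1). *)
Definition cy_rep (w : weight) : weight := w - const_mx (w 0 ord_max).
Definition cy (f : laurent) : laurent :=
  \sum_(w <- dom f) << coeff w f *g cy_rep w >>.

(** * The field K and the square roots w_pi *)

Notation K := {fraction {mpoly rat[3]}}.

(* lambda_1, lambda_2, lambda_3, and lambda_4 = - (lambda_1+lambda_2+lambda_3) *)
Definition lam (i : 'I_4) : K :=
  (tnth [tuple 'X_0; 'X_1; 'X_(inord 2);
        - ('X_0 + 'X_1 + 'X_(inord 2))] i)%:F.

(* The exponents are integers; 0 ^ 0 = 1 and 0 ^ n = 0 for n > 0, which are the
   conventions for the trivial weight (whose coefficient is nonpositive). *)
Definition eT_neg (f : laurent) : K :=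
  let c := cy f in
  \prod_(w <- dom c) (\sum_(i < 4) lam i *~ w 0 i) ^ (- coeff w c).

(* "x is a choice of w_pi" *)
Definition is_w (pi : array3) (x : K) : Prop :=
  x ^+ 2 = (-1) ^+ psize pi * eT_neg (Vchar pi).

(* L_pi(d_1, d_2, d_3, d_4) over any ring in which the lambda_i and the d_i
   have been given values. *)
Definition Lprod (R : comNzRingType) (la d : 'I_4 -> R) (pi : array3) : R :=
  \prod_(b <- finsupp pi) \prod_(l < pi b)
     \sum_(i < 4) (d i + (tnth (box b l) i)%:R) * la i.

(** * Poles and restriction along lambda_1 + lambda_2 + lambda_3 = 0 *)

(* The function field of the hyperplane, with coordinates lambda_1, lambda_2. *)
Notation K0 := {fraction {mpoly rat[2]}}.

Definition hyp_restr (p : {mpoly rat[3]}) : {mpoly rat[2]} :=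
  comp_mpoly [tuple 'X_0; 'X_1; - ('X_0 + 'X_1)] p.

Definition regular (f : K) : Prop :=
  exists p q : {mpoly rat[3]}, hyp_restr q != 0 /\ f = p%:F / q%:F.

(* f has no pole along the hyperplane and specializes to g. *)
Definition specializes (f : K) (g : K0) : Prop :=
  exists p q : {mpoly rat[3]},
    [/\ hyp_restr q != 0, f = p%:F / q%:F
      & g = (hyp_restr p)%:F / (hyp_restr q)%:F].

(** * Properties (a), (b), (c) *)

(* L_pi(0,0,0,-d) x as a polynomial over K; [d] is 'X when d is a formal
   variable, and a constant when d is a number. *)
Definition Lw (d : {poly rat}) (pi : array3) (x : K) : {poly K} :=
  Lprod (fun i => (lam i)%:P)
        (fun i => if i == ord_max then - map_poly ratr d else 0) pi * x%:P.

Definition poly_specializes (F : {poly K}) (G : {poly K0}) : Prop :=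
  forall i : nat, specializes F`_i G`_i.

Definition prop_a (d : {poly rat}) (pi : array3) (x : K) : Prop :=
  forall i : nat, regular (Lw d pi x)`_i.

Definition prop_b (d : {poly rat}) (pi : array3) (x : K) : Prop :=
  exists r : {poly rat}, poly_specializes (Lw d pi x) (map_poly ratr r).

Definition c_rhs (d : {poly rat}) (pi : array3) (omega : rat) : {poly rat} :=
  ((-1) ^+ psize pi * omega) *: \prod_(l < pi (0, 0, 0)%N) (d - l%:R).

Definition prop_c (d : {poly rat}) (pi : array3) (x : K) : Prop :=
  exists omega : rat,
    0 < omega /\ poly_specializes (Lw d pi x) (map_poly ratr (c_rhs d pi omega)).

(* The equation of (c) up to an overall sign, for a given omega. *)
Definition c_sign (d : {poly rat}) (pi : array3) (x : K) (omega : rat) : Prop :=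
  poly_specializes (Lw d pi x) (map_poly ratr (c_rhs d pi omega)) \/
  poly_specializes (Lw d pi x) (map_poly ratr (- c_rhs d pi omega)).

Definition prop_c_sign (d : {poly rat}) (pi : array3) (x : K) : Prop :=
  exists omega : rat, 0 < omega /\ c_sign d pi x omega.

(** * Formal power series in q, as coefficient sequences *)

Section Series.
Variable F : fieldType.
Definition series := nat -> F.
Implicit Types f g : series.

Definition smul f g : series := fun n => \sum_(i < n.+1) f i * g (n - i)%N.
Definition sone : series := fun n => (n == 0%N)%:R.
Definition spow f (k : nat) : series := iter k (smul f) sone.

(* For f with constant term 1; the terms k > n do not contribute. *)
Definition slog f : series := fun n =>
  \sum_(1 <= k < n.+1) (-1) ^+ k.+1 / k%:R * spow (fun m => f m - sone m) k n.
(* For f with constant term 0; the terms k > n do not contribute. *)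
Definition sexp f : series := fun n =>
  \sum_(0 <= k < n.+1) (k`!%:R)^-1 * spow f k n.

(* 1 / (1 - q^m) *)
Definition geom (m : nat) : series := fun n => (m %| n)%:R.

(* The factors with m > n do not contribute to the coefficient of q^n. *)
Definition macmahon : series := fun n =>
  (\big[smul/sone]_(1 <= m < n.+1) spow (geom m) m) n.

(* M(-q)^a *)
Definition macmahon_neg_pow (a : F) : series :=
  sexp (fun n => a * slog (fun m => (-1) ^+ m * macmahon m) n).
End Series.

(** * The generating series *)

(* K(d_1, d_2, d_3, d_4) *)
Notation KD := {fraction {mpoly K[4]}}.
Definition toKD (x : K) : KD := (x%:MP_[4])%:F.
Definition dvar (i : 'I_4) : KD := ('X_i)%:F.

Definition mm_exponent : KD :=
  let l i := toKD (lam (inord i)) in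
  (\sum_(i < 4) dvar i * toKD (lam i))
  * (- l 0%N * l 1%N * l 2%N - l 0%N * l 1%N * l 3%N
     - l 0%N * l 2%N * l 3%N - l 1%N * l 2%N * l 3%N)
  / (l 0%N * l 1%N * l 2%N * l 3%N).

(* The generating series identity modulo q^7. *)
Definition sign_identity (w : array3 -> K) : Prop :=
  forall n : nat, (n < 7)%N ->
    \sum_(pi \in [set pi | solid pi /\ psize pi = n])
       Lprod (fun i => toKD (lam i)) dvar pi * toKD (w pi)
    = macmahon_neg_pow mm_exponent n.

(** * The characters listed explicitly *)

Definition listed : seq laurent :=
  [:: 1 + t1 + t2 + t1 * t2 + t3 + t4 + t4 ^+ 2;
      1 + t1 + t2 + t1 * t2 + t3 + t4 + t1 * t4 + t4 ^+ 2;
      1 + t1 + t1 ^+ 2 + t2 + t1 * t2 + t3 + t4 + t1 * t4 + t4 ^+ 2;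
      1 + t1 + t1 ^+ 2 + t2 + t1 * t2 + t2 * t3 + t3 + t4 + t1 * t4 + t4 ^+ 2;
      1 + t1 + t1 ^+ 2 + t2 + t1 * t2 + t2 * t3 + t3 + t4 + t1 * t4 + t2 * t4
        + t4 ^+ 2;
      1 + t1 + t1 ^+ 2 + t2 + t1 * t2 + t2 * t3 + t3 + t4 + t1 * t4 + t2 * t4
        + t4 ^+ 2 + t4 ^+ 3;
      1 + t1 + t1 ^+ 2 + t2 + t1 * t2 + t2 * t3 + t3 + t4 + t1 * t4 + t2 * t4
        + t4 ^+ 2 + t4 ^+ 3 + t4 ^+ 4;
      1 + t1 + t1 ^+ 2 + t2 + t1 * t2 + t2 * t3 + t3 + t4 + t1 * t4 + t2 * t4
        + t4 ^+ 2 + t4 ^+ 3 + t4 ^+ 4 + t4 ^+ 5;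
      1 + t1 + t1 ^+ 2 + t2 + t2 ^+ 2 + t1 * t2 + t2 * t3 + t3 + t4 + t1 * t4
        + t2 * t4 + t4 ^+ 2 + t4 ^+ 3 + t4 ^+ 4 + t4 ^+ 5].

(* Main.v *)
(* Put t1 t2 t3 t4 = 1.  Then V = v + bar v with
   v = Z - Z bar Z (1 - 1/t1)(1 - 1/t2)(1 - 1/t3), so that w_pi = +- e(-v).
   Restrict to lambda_4 = 0, i.e. t4 = 1.  There (1 - t1)(1 - t2)(1 - t3) has the
   form bar p - p, so the quadratic part of v contributes only a sign away from the
   weights (n,n,n,m), and Z cancels against the factors of L.  A weight (n,n,n,m)
   evaluates to (m - n) lambda_4; the powers of lambda_4 cancel because V has no
   weight (n,n,n,n).  Hence for every solid partition L(0,0,0,-d) w specializes to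
     +- omega * prod (d - (l - i)),
   the product being over the boxes (i,i,i,l) (indices from 0), where omega is the
   product of |m - n|^(-v_(n,n,n,m)) over the weights with m <> n.
   If pi_222 = 0 these boxes are the (0,0,0,l), which is (c) up to sign.  If
   pi_111 = 1, then v - bar Z / (t1 t2 t3) has no weight (n,n,n,0), and this gives
   omega * prod (1 + i) = 1.
   For the signs in (1), put d = 6 in the generating series and restrict: with all
   signs (-1)^|pi| the coefficient of (-q)^n is a sum of positive terms, and an
   enumeration shows that this sum is the coefficient of q^n in M(q)^6; so no other
   choice of signs can give the series. *)

Require Import Defs.
From Stdlib Require Import ZArith QArith.
From HB Require Import structures.
From mathcomp Require Import all_boot all_order all_algebra fraction finmap.
From mathcomp Require Import mpoly freeg.
From mathcomp Require Import boolp classical_sets fsbigop.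
From mathcomp Require Import zify ring ssrZ.

Set Implicit Arguments.
Unset Strict Implicit.
Unset Printing Implicit Defensive.

Import Order.TTheory GRing.Theory Num.Theory.
Local Close Scope Q_scope.
Local Close Scope Z_scope.
Local Open Scope ring_scope.
Local Notation "x %:F" := (tofrac x).

(** * Induction and coefficients for Laurent polynomials *)

(** Monomials generate the additive group, so an identity additive in [f] need only be checked on
    them. *)
Lemma laurent_ind (P : laurent -> Prop) :
  P 0 -> (forall w, P (mono w)) -> (forall f, P f -> P (- f)) ->
  (forall f g, P f -> P g -> P (f + g)) -> forall f, P f.
Proof.
move=> P0 Pm PN PD; elim/freeg_ind_dom0=> // c w f _ _ Pf.
apply: (PD _ _ _ Pf).
have PU n : P << n%:Z *g w >>.
  elim: n => [|n IHn]; first by rewrite freegU0.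
  by rewrite -[n.+1]addn1 PoszD -freegUD; apply: (PD _ _ IHn (Pm w)).
by case: c => [n|n] //; rewrite NegzE -freegUN; apply: PN.
Qed.

Lemma monoD u w : mono (u + w) = mono u * mono w.
Proof. by rewrite [RHS]lmulUU mulr1. Qed.

Lemma coeff_mono u w : coeff u (mono w) = (w == u)%:R.
Proof. by rewrite coeffU mul1r. Qed.

Lemma coeff_mulmono (f : laurent) u w : coeff u (f * mono w) = coeff (u - w) f.
Proof.
elim/laurent_ind: f => [|v|f|f g].
- by rewrite mul0r !coeff0.
- by rewrite -monoD !coeff_mono (can2_eq (addrK _) (subrK _)).
- by rewrite mulNr !coeffN => ->.
by rewrite mulrDl !coeffD => -> ->.
Qed.

(** * Pushforward along maps of weights *)

Definition push (phi : weight -> weight) (f : laurent) : laurent :=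
  \sum_(w <- dom f) << coeff w f *g phi w >>.

Lemma push_is_zmod_morphism phi : zmod_morphism (push phi).
Proof.
have pD f g : push phi (f + g) = push phi f + push phi g.
  by apply: (@sum_domD _ (fun w c => << c *g phi w >>)) => u a b; rewrite freegUD.
have p0 : push phi 0 = 0 by apply: (addrI (push phi 0)); rewrite -pD !addr0.
have pN f : push phi (- f) = - push phi f.
  by apply/eqP; rewrite -addr_eq0 -pD addNr p0.
by move=> f g; rewrite pD pN.
Qed.

HB.instance Definition _ phi := GRing.isZmodMorphism.Build _ _ (push phi)
  (push_is_zmod_morphism phi).

Lemma push_mono phi w : push phi (mono w) = mono (phi w).
Proof.
by rewrite [LHS](@sum_domU _ (fun w c => << c *g phi w >>)) // => u; rewrite freegU0.
Qed.

(** Additivity of [phi] sends products of monomials to products. The instances used are negation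
    (that is, [lbar]), [cy_rep] (that is, [cy]), [hyp_rep] and [flat]. *)
Lemma push_is_monoid_morphism (phi : {additive weight -> weight}) :
  monoid_morphism (push phi).
Proof.
split=> [|f g]; first by rewrite [LHS]push_mono raddf0.
elim/laurent_ind: f => [|v|f IHf|f f' IHf IHf'].
- by rewrite mul0r raddf0 mul0r.
- elim/laurent_ind: g => [|w|g IHg|g g' IHg IHg'].
  + by rewrite mulr0 raddf0 mulr0.
  + by rewrite -monoD !push_mono raddfD monoD.
  + by rewrite mulrN !raddfN /= IHg mulrN.
  + by rewrite mulrDr !raddfD /= IHg IHg' mulrDr.
- by rewrite mulNr !raddfN /= IHf mulNr.
by rewrite mulrDl !raddfD /= IHf IHf' mulrDl.
Qed.

HB.instance Definition _ (phi : {additive weight -> weight}) :=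
  GRing.isMonoidMorphism.Build laurent laurent (push phi) (push_is_monoid_morphism phi).

Lemma mem_dom_push phi f w : w \in dom (push phi f) -> exists2 u, u \in dom f & phi u = w.
Proof.
move=> wf; apply: contrapT => nex; move: wf; rewrite mem_dom; case/negP.
rewrite raddf_sum big_seq big1 //= => u uf; rewrite coeffU.
by case: eqP => [e|]; rewrite ?mulr0 //; case: nex; exists u.
Qed.

Lemma cy_rep_is_zmod_morphism : zmod_morphism cy_rep.
Proof. by move=> u v; apply/rowP => i; rewrite !mxE; ring. Qed.

HB.instance Definition _ := GRing.isZmodMorphism.Build _ _ cy_rep cy_rep_is_zmod_morphism.

(** * Products over the weights of a character *)

Definition unz (F : fieldType) (x : F) : F := if x == 0 then 1 else x.

Section WeightProduct.
Variable F : fieldType.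
Implicit Types h : weight -> F.

Lemma unz_neq0 (x : F) : unz x != 0.
Proof. by rewrite /unz; case: ifP => [_|->//]; exact: oner_neq0. Qed.

Lemma unz_id (x : F) : x != 0 -> unz x = x.
Proof. by rewrite /unz => /negPf ->. Qed.

(* Replacing the zeros of [h] by 1 makes this multiplicative in [f] for all [h]. *)
Definition wprod h (f : laurent) : F := \prod_(w <- dom f) unz (h w) ^ coeff w f.

Lemma wprod_sup h f (r : seq weight) : uniq r -> {subset dom f <= r} ->
  wprod h f = \prod_(w <- r) unz (h w) ^ coeff w f.
Proof.
move=> ur sr; rewrite [RHS](bigID (mem (dom f))) /= [X in _ * X]big1 ?mulr1.
  rewrite -[RHS]big_filter; apply: perm_big; apply: uniq_perm; rewrite ?uniq_dom ?filter_uniq //.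
  by move=> u; rewrite mem_filter /=; case: (boolP (u \in dom f)) => // /sr ->.
by move=> u /coeff_outdom ->.
Qed.

Lemma wprodD h f g : wprod h (f + g) = wprod h f * wprod h g.
Proof.
pose r := undup (dom (f + g) ++ dom f ++ dom g).
have ur : uniq r by exact: undup_uniq.
have sr k : k \in dom (f + g) ++ dom f ++ dom g -> k \in r by rewrite mem_undup.
rewrite !(@wprod_sup h _ r) //; last first.
- by move=> u uf; apply: sr; rewrite !mem_cat uf.
- by move=> u uf; apply: sr; rewrite !mem_cat uf orbT.
- by move=> u uf; apply: sr; rewrite !mem_cat uf !orbT.
by rewrite -big_split; apply: eq_bigr => u _; rewrite coeffD expfzDr ?unz_neq0.
Qed.

Lemma wprod0 h : wprod h 0 = 1.
Proof. by rewrite (@wprod_sup h 0 [::]) ?big_nil // => u; rewrite dom0. Qed.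

Lemma wprod_neq0 h f : wprod h f != 0.
Proof. by rewrite /wprod prodf_seq_neq0; apply/allP => w _; rewrite expfz_neq0 ?unz_neq0. Qed.

Lemma wprodN h f : wprod h (- f) = (wprod h f)^-1.
Proof.
by apply: (mulfI (wprod_neq0 h f)); rewrite -wprodD subrr wprod0 divff ?wprod_neq0.
Qed.

Lemma wprodB h f g : wprod h (f - g) = wprod h f / wprod h g.
Proof. by rewrite wprodD wprodN. Qed.

Lemma wprod_mono h w : wprod h (mono w) = unz (h w).
Proof.
rewrite (@wprod_sup h _ [:: w]) ?big_seq1 ?coeff_mono ?eqxx ?expr1z //.
by move=> u; rewrite mem_dom coeff_mono mem_seq1 (eq_sym u); case: (w == u).
Qed.

Lemma wprod_sum h (I : Type) (r : seq I) (f : I -> laurent) :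
  wprod h (\sum_(i <- r) f i) = \prod_(i <- r) wprod h (f i).
Proof. by apply: (big_morph (wprod h) (wprodD h) (wprod0 h)). Qed.

Lemma wprod_split h g k f : (forall w, unz (h w) = unz (g w) * unz (k w)) ->
  wprod h f = wprod g f * wprod k f.
Proof.
move=> e; rewrite -big_split; apply: eq_bigr => w _.
by rewrite e expfzMl.
Qed.

Lemma wprod_push h phi f : wprod h (push phi f) = wprod (h \o phi) f.
Proof.
elim/laurent_ind: f => [|v|f IHf|f g IHf IHg].
- by rewrite raddf0 !wprod0.
- by rewrite push_mono !wprod_mono.
- by rewrite raddfN /= !wprodN IHf.
by rewrite raddfD /= !wprodD IHf IHg.
Qed.

Lemma wprod_mulmono h f u : wprod h (f * mono u) = wprod (fun w => h (w + u)) f.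
Proof.
elim/laurent_ind: f => [|v|f IHf|f g IHf IHg].
- by rewrite mul0r !wprod0.
- by rewrite -monoD !wprod_mono.
- by rewrite mulNr !wprodN IHf.
by rewrite mulrDl !wprodD IHf IHg.
Qed.

Lemma wprod1 h f : (forall w, w \in dom f -> unz (h w) = 1) -> wprod h f = 1.
Proof. by move=> h1; apply: big1_seq => w /h1 ->; rewrite exp1rz. Qed.

Lemma eq_wprod h g f : (forall w, unz (h w) = unz (g w)) -> wprod h f = wprod g f.
Proof. by move=> e; apply: eq_bigr => w _; rewrite e. Qed.

(** Changing the sign of [h] at some weights changes the product only by a sign; squares express
    this without tracking the sign. *)
Lemma wprod_sqr h g f : (forall w, h w ^+ 2 = g w ^+ 2) ->
  wprod h f ^+ 2 = wprod g f ^+ 2.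
Proof.
move=> e; rewrite /wprod -!prodrXl; apply: eq_bigr => w _.
suff {f} e1 : unz (h w) ^+ 2 = unz (g w) ^+ 2.
  by rewrite !expr2 -!expfzMl -!expr2 e1.
have e0 : (h w == 0) = (g w == 0) by rewrite -sqrf_eq0 e sqrf_eq0.
by rewrite /unz e0; case: ifP => // _; apply: e.
Qed.
End WeightProduct.

(** * Boxes *)

Definition char (B : seq weight) : laurent := \sum_(a <- B) mono a.

(** The four-dimensional diagram of a solid partition, seen inside the weight lattice, where the
    four coordinates play symmetric roles. *)
Definition order_ideal (B : seq weight) : Prop :=
  [/\ uniq B, forall (a : weight) i, a \in B -> 0 <= a 0 i
    & forall a u : weight, a \in B -> (forall i, 0 <= u 0 i <= a 0 i) -> u \in B].

Definition bweight (b : nat * nat * nat) (l : nat) : weight :=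
  \row_(i < 4) (tnth (box b l) i)%:Z.

Definition boxes (pi : array3) : seq weight :=
  [seq bweight b l | b <- finsupp pi, l <- iota 0 (pi b)].

Lemma big_boxes (R : Type) (idx : R) (op : Monoid.com_law idx) (h : weight -> R) pi :
  \big[op/idx]_(a <- boxes pi) h a =
  \big[op/idx]_(b <- finsupp pi) \big[op/idx]_(l < pi b) h (bweight b l).
Proof.
rewrite big_allpairs_dep /=; apply: eq_bigr => b _.
by rewrite -[in RHS](big_mkord xpredT (h \o bweight b)) /index_iota subn0.
Qed.

Lemma Zchar_boxes pi : Zchar pi = char (boxes pi).
Proof. by rewrite /char big_boxes. Qed.

Lemma bweightE i j k l (w : weight) :
  (w == bweight (i, j, k) l) =
  [&& w 0 (inord 0) == i, w 0 (inord 1) == j, w 0 (inord 2) == k & w 0 (inord 3) == l].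
Proof.
apply/eqP/and4P => [->|[/eqP h0 /eqP h1 /eqP h2 /eqP h3]].
  by rewrite !mxE !(tnth_nth 0%N) /= !inordK.
apply/rowP => m; rewrite mxE (tnth_nth 0%N) /=.
case: m => -[|[|[|[|//]]]] lt; rewrite /= -?h0 -?h1 -?h2 -?h3;
  congr (w _ _); apply: val_inj; rewrite /= inordK //.
Qed.

Lemma mem_boxes pi i j k l : (bweight (i, j, k) l \in boxes pi) = (l < pi (i, j, k))%N.
Proof.
apply/allpairsPdep/idP => [[[[i' j'] k'] [l' [_]]]|lt].
  rewrite mem_iota add0n => /andP[_ lt] /eqP.
  rewrite bweightE !mxE !(tnth_nth 0%N) /= !inordK //= !eqz_nat.
  by case/and4P=> /eqP-> /eqP-> /eqP-> /eqP->.
exists (i, j, k), l; rewrite mem_iota add0n; split=> //.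
by rewrite mem_finsupp -lt0n; apply: leq_trans lt.
Qed.

Lemma boxesP pi a : a \in boxes pi -> exists i j k l, a = bweight (i, j, k) l.
Proof. by case/allpairsPdep => -[[i j] k] [l [_ _ ->]]; exists i, j, k, l. Qed.

Lemma solid_mono pi i j k i' j' k' : solid pi -> (i <= i')%N -> (j <= j')%N ->
  (k <= k')%N -> (pi (i', j', k') <= pi (i, j, k))%N.
Proof.
move=> s /subnKC <- /subnKC <- /subnKC <-; move: (i' - i)%N (j' - j)%N (k' - k)%N => x y z.
have Hx m j0 k0 : (pi (i + m, j0, k0) <= pi (i, j0, k0))%N.
  elim: m => [|m IHm]; rewrite ?addn0 // addnS.
  by have [h _ _] := s (i + m)%N j0 k0; apply: leq_trans h IHm.
have Hy m i0 k0 : (pi (i0, j + m, k0) <= pi (i0, j, k0))%N.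
  elim: m => [|m IHm]; rewrite ?addn0 // addnS.
  by have [_ h _] := s i0 (j + m)%N k0; apply: leq_trans h IHm.
have Hz m i0 j0 : (pi (i0, j0, k + m) <= pi (i0, j0, k))%N.
  elim: m => [|m IHm]; rewrite ?addn0 // addnS.
  by have [_ _ h] := s i0 j0 (k + m)%N; apply: leq_trans h IHm.
exact: leq_trans (Hx _ _ _) (leq_trans (Hy _ _ _) (Hz _ _ _)).
Qed.

Lemma boxes_ideal pi : solid pi -> order_ideal (boxes pi).
Proof.
move=> s; split.
- apply: allpairs_uniq_dep => [|b _|]; first exact: fset_uniq; first exact: iota_uniq.
  move=> [[[i j] k] l] [[[i' j'] k'] l'] _ _ /= /eqP.
  rewrite bweightE !mxE !(tnth_nth 0%N) /= !inordK //= !eqz_nat.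
  by case/and4P=> /eqP-> /eqP-> /eqP-> /eqP->.
- by move=> a m /boxesP[i [j [k [l ->]]]]; rewrite mxE.
move=> a u ain; have [i [j [k [l ea]]]] := boxesP ain.
move: ain; rewrite ea mem_boxes =>  ain hu.
pose n (m : nat) := absz (u 0 (inord m)).
have un (m : nat) : (m < 4)%N ->
    (u 0 (inord m) = n m) /\ (n m <= nth 0%N [:: i; j; k; l] m)%N.
  move=> m4; have := hu (inord m); rewrite mxE (tnth_nth 0%N) /= inordK //.
  by rewrite /n => /andP[h0 h1]; split; lia.
have [e0 n0] := un 0%N isT; have [e1 n1] := un 1%N isT.
have [e2 n2] := un 2%N isT; have [e3 n3] := un 3%N isT.
have -> : u = bweight (n 0%N, n 1%N, n 2%N) (n 3%N).
  by apply/eqP; rewrite bweightE e0 e1 e2 e3 !eqxx.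
by rewrite mem_boxes (leq_ltn_trans n3 (leq_trans ain _)) //; apply: solid_mono.
Qed.

(** * The bar involution and coefficients of products with the factors $1-t_i$ *)

Lemma lbarE f : lbar f = push -%R f. Proof. by []. Qed.

Lemma lbar_mono w : lbar (mono w) = mono (- w).
Proof. by rewrite lbarE push_mono. Qed.

Lemma lbar_char B : lbar (char B) = \sum_(a <- B) mono (- a).
Proof. by rewrite lbarE raddf_sum; apply: eq_bigr => a _; apply: lbar_mono. Qed.

Lemma coeff_lbar u f : coeff u (lbar f) = coeff (- u) f.
Proof.
rewrite lbarE; elim/laurent_ind: f => [|w|f IHf|f g IHf IHg].
- by rewrite raddf0 !coeff0.
- by rewrite push_mono !coeff_mono eqr_oppLR.
- by rewrite raddfN /= !coeffN IHf.
by rewrite raddfD /= !coeffD IHf IHg.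
Qed.

Lemma coeff_sum u (I : Type) (r : seq I) (f : I -> laurent) :
  coeff u (\sum_(i <- r) f i) = \sum_(i <- r) coeff u (f i).
Proof. by rewrite raddf_sum. Qed.

Lemma coeff_char B u : uniq B -> coeff u (char B) = (u \in B)%:R.
Proof.
move=> uB; rewrite coeff_sum; under eq_bigr do rewrite coeff_mono.
have [uin|nin] := boolP (u \in B).
  rewrite (bigD1_seq u) //= eqxx big1 ?addr0 // => a /negPf.
  by move=> ->.
by rewrite big1_seq // => a /andP[_ ain]; case: eqP => // e; rewrite -e ain in nin.
Qed.

Definition tvar (i : nat) : laurent := mono (delta_mx 0 (inord i)).

Definition cube (n : nat) : laurent := \prod_(i < n) (1 - tvar i).

Lemma cubeS n : cube n.+1 = cube n * (1 - tvar n).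
Proof. by rewrite /cube big_ord_recr. Qed.

(* For [u >= 0], the coefficient of [t^u] in [Z * lbar Z] counts the boxes
   [a >= u], because [B] is an order ideal; each factor [1 - t_i] then turns the
   condition [u_i <= a_i] into [a_i = u_i - 1]. *)
Lemma coeff_cube B n (u : weight) : order_ideal B -> (n <= 4)%N ->
  (forall i : 'I_4, ((i < n)%N : nat)%:Z <= u 0 i) ->
  coeff u (char B * lbar (char B) * cube n) =
  (-1) ^+ n * \sum_(a <- B) [forall i : 'I_4,
     if (i < n)%N then a 0 i == u 0 i - 1 else u 0 i <= a 0 i]%:R.
Proof.
case=> uB B0 Bd; elim: n u => [|n IHn] u.
  move=> _ u0; rewrite /cube big_ord0 mulr1 expr0 mul1r /char mulr_suml coeff_sum.
  apply: eq_big_seq => a ain; rewrite -/(char B) lbar_char mulr_sumr coeff_sum.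
  under eq_bigr do rewrite -monoD coeff_mono.
  (* Since $u\geq0$, any box $a\geq u$ gives $0\leq a-u\leq a$, so the ideal contains $a-u$;
     conversely $a-u$ in the ideal has nonnegative coordinates. *)
  have -> : [forall i : 'I_4, if (i < 0)%N then a 0 i == u 0 i - 1 else u 0 i <= a 0 i]
            = (a - u \in B).
    apply/forallP/idP => [h|h i /=].
      by apply: Bd ain _ => i; have := h i; have := u0 i; rewrite !ltn0 !mxE /=; lia.
    by have := B0 _ i h; rewrite !mxE subr_ge0.
  rewrite -coeff_char // coeff_sum; apply: eq_bigr => b _; rewrite coeff_mono.
  by rewrite subr_eq addrC -subr_eq eq_sym.
move=> n4 hu; rewrite cubeS mulrA mulrBr mulr1 coeffB coeff_mulmono.
have le_n4 : (n <= 4)%N by apply: ltnW.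
rewrite !IHn //; first last.
- move=> i; apply: le_trans (hu i); by lia.
- move=> i; have := hu i; rewrite !mxE eqxx /=.
  case: (eqVneq i (inord n)) => [->|_]; last by lia.
  by rewrite inordK //; lia.
rewrite -mulrBr exprSr -mulrA mulN1r; congr (_ * _).
rewrite -sumrB -sumrN; apply: eq_bigr => a _.
(* The coefficients at $u$ and at $u-e_n$ share the conditions [C] on the other coordinates. In
   coordinate $n$ the difference of the conditions is
   $[u_n\leq a_n]-[u_n-1\leq a_n]=-[a_n=u_n-1]$. *)
pose C := [forall i : 'I_4, (i != inord n) ==>
     if (i < n)%N then a 0 i == u 0 i - 1 else u 0 i <= a 0 i].
have split_n (Q : 'I_4 -> bool) : (forall i : 'I_4, i != inord n ->
     Q i = if (i < n)%N then a 0 i == u 0 i - 1 else u 0 i <= a 0 i) ->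
     [forall i, Q i] = Q (inord n) && C.
  move=> hQ; apply/forallP/andP => [h|[hn /forallP offdiag_lw] i].
    by split=> //; apply/forallP => i; apply/implyP => ni; rewrite -hQ.
  by case: (eqVneq i (inord n)) => [->|ni] //; rewrite hQ //; apply: (implyP (offdiag_lw i)).
rewrite !split_n.
- rewrite !mxE eqxx inordK // ltnn leqnn /= eqxx.
  by case: (C); rewrite ?andbF ?andbT //; lia.
- move=> i ni; rewrite ltnS leq_eqVlt.
  suff -> : (i == n :> nat) = false by [].
  by apply: contraNF ni => /eqP <-; rewrite inord_val.
- by move=> i ni; rewrite !mxE eqxx /= (negPf ni) subr0.
by [].
Qed.

Lemma cube4 : cube 4 = (1 - t1) * (1 - t2) * (1 - t3) * (1 - t4).
Proof. by rewrite !cubeS /cube big_ord0 mul1r. Qed.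

Lemma cube3 : cube 3 = (1 - t1) * (1 - t2) * (1 - t3).
Proof. by rewrite !cubeS /cube big_ord0 mul1r. Qed.

Lemma lbarM f g : lbar (f * g) = lbar f * lbar g.
Proof. by rewrite !lbarE rmorphM. Qed.
Lemma lbarB f g : lbar (f - g) = lbar f - lbar g.
Proof. by rewrite !lbarE rmorphB. Qed.
Lemma lbarD f g : lbar (f + g) = lbar f + lbar g.
Proof. by rewrite !lbarE rmorphD. Qed.
Lemma lbarN f : lbar (- f) = - lbar f.
Proof. by rewrite !lbarE raddfN. Qed.
Lemma lbar1 : lbar 1 = 1.
Proof. by rewrite lbarE rmorph1. Qed.

Lemma lbarK : involutive lbar.
Proof.
elim/laurent_ind => [|w|f IHf|f g IHf IHg].
- by rewrite !lbarE !raddf0.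
- by rewrite !lbar_mono opprK.
- by rewrite !lbarN IHf.
by rewrite !lbarD IHf IHg.
Qed.

(** * Splitting of the vertex into two dual halves *)

Definition tinv1 (i : nat) : laurent := mono (- delta_mx 0 (inord i)).

Lemma tvar_tinv1 i : tvar i * tinv1 i = 1.
Proof. by rewrite -monoD subrr. Qed.

Lemma lbar_tvar i : lbar (tvar i) = tinv1 i.
Proof. exact: lbar_mono. Qed.

Definition tinv3 : laurent := tinv1 0 * tinv1 1 * tinv1 2.

Lemma tinvE : tinv = tinv3 * tinv1 3.
Proof.
rewrite /tinv3 /tinv1 -!monoD; congr mono; apply/rowP => m; rewrite !mxE eqxx /=.
by case: m => -[|[|[|[|//]]]] lt; rewrite -!val_eqE /= !inordK.
Qed.

(** Each factor satisfies $1-t_i^{-1}=-(1-t_i)t_i^{-1}$, and there are three of them. *)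
Lemma lbar_cube3 : lbar (cube 3) = - (cube 3 * tinv3).
Proof.
rewrite cube3 !(lbarM, lbarB, lbar1) /t1 /t2 /t3 -!/(tvar _) !lbar_tvar /tinv3.
have := tvar_tinv1 0; have := tvar_tinv1 1; have := tvar_tinv1 2.
move: (tinv1 0) (tinv1 1) (tinv1 2) (tvar 0) (tvar 1) (tvar 2) => a b c x y z zc yb xa.
have -> : (1 - x) * (1 - y) * (1 - z) * (a * b * c) =
  (a - x * a) * (b - y * b) * (c - z * c) by ring.
by rewrite zc yb xa; ring.
Qed.

(* The half of the vertex: [V = v + lbar v] once t1 t2 t3 t4 = 1. *)
Definition vhalf (Z : laurent) : laurent := Z - Z * lbar Z * lbar (cube 3).

(** The factor $1-t_4$ splits the quadratic term: its part with $t_4$ belongs to the first half and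
    its part with 1 to the dual half. The identity holds before $t_1t_2t_3t_4=1$ is imposed; [tinv]
    becomes 1 afterwards. *)
Lemma Vchar_half pi : Vchar pi = vhalf (Zchar pi) + lbar (vhalf (Zchar pi)) * tinv.
Proof.
rewrite /Vchar /vhalf; move: (Zchar pi) => Z.
rewrite lbarB !lbarM !lbarK lbar_cube3 -!mulrA [(1 - t1) * _]mulrA.
rewrite [(1 - t1) * (1 - t2) * _]mulrA -cube3 tinvE /t4 -/(tvar 3).
have := tvar_tinv1 3.
move: (lbar Z) (tinv1 3) (tvar 3) tinv3 (cube 3) => Y b x i P xb.
have -> : (1 - x) * (i * b) = i * b - i * (x * b) by ring.
by rewrite xb; ring.
Qed.

(** For $n\geq0$, by [coeff_cube] at $(n+1,\ldots,n+1)$ the quadratic term counts the box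
    $(n,n,n,n)$ with sign $(-1)^4$, which cancels its contribution to $Z$; the dual term contributes
    nothing. Negative weights follow because the two halves are exchanged by $n\mapsto-1-n$. *)
Lemma Vchar_const pi n : solid pi -> coeff (const_mx n) (Vchar pi) = 0.
Proof.
move=> s; have [uB B0 Bd] := boxes_ideal s.
have nonneg (m : nat) : coeff (const_mx m%:Z) (Vchar pi) = 0.
  have -> : Vchar pi = Zchar pi + lbar (Zchar pi) * tinv
                       - Zchar pi * lbar (Zchar pi) * cube 4 * tinv.
    by rewrite cube4 !mulrA.
  rewrite coeffB coeffD !coeff_mulmono coeff_lbar Zchar_boxes !coeff_char //.
  have -> : (- (const_mx m%:Z - const_mx (-1)) \in boxes pi) = false.
    apply/negP => /(B0 _ 0); rewrite !mxE; lia.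
  rewrite coeff_cube; first last.
  - by move=> i; rewrite !mxE ltn_ord; lia.
  - by [].
  - exact: boxes_ideal.
  have -> : \sum_(a <- boxes pi)
      [forall i : 'I_4, if (i < 4)%N
         then a 0 i == (const_mx m%:Z - const_mx (-1) : weight) 0 i - 1
         else (const_mx m%:Z - const_mx (-1) : weight) 0 i <= a 0 i]%:R
      = \sum_(a <- boxes pi) coeff (const_mx m%:Z) (mono a).
    apply: eq_bigr => a _; rewrite coeff_mono; congr (_ %:R); congr nat_of_bool.
    apply/forallP/eqP => [h|-> i].
      apply/rowP => i; have := h i; rewrite ltn_ord !mxE => /eqP ->; lia.
    by rewrite ltn_ord !mxE; lia.
  by rewrite -coeff_sum coeff_char //; case: (_ \in _).
case: n => [m|m]; first exact: nonneg.
have := nonneg m; rewrite !Vchar_half !(coeffD _ (vhalf _)) !coeff_mulmono !coeff_lbar.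
have -> : - (const_mx (Negz m) - const_mx (-1)) = const_mx m%:Z :> weight.
  by apply/rowP => i; rewrite !mxE; lia.
have -> : - (const_mx m%:Z - const_mx (-1)) = const_mx (Negz m) :> weight.
  by apply/rowP => i; rewrite !mxE; lia.
by rewrite addrC.
Qed.

(** * The linear forms of weights over [K] *)

Lemma sum4 (R : zmodType) (F : 'I_4 -> R) :
  \sum_(i < 4) F i = F (inord 0) + F (inord 1) + F (inord 2) + F (inord 3).
Proof.
rewrite !big_ord_recr big_ord0 /= add0r.
by congr (F _ + F _ + F _ + F _); apply: val_inj; rewrite /= inordK.
Qed.

Lemma weightP (u w : weight) : u 0 (inord 0) = w 0 (inord 0) ->
  u 0 (inord 1) = w 0 (inord 1) -> u 0 (inord 2) = w 0 (inord 2) ->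
  u 0 (inord 3) = w 0 (inord 3) -> u = w.
Proof.
move=> h0 h1 h2 h3; apply/rowP => -[[|[|[|[|//]]]] lt].
- by move: h0; congr (u _ _ = w _ _); apply: val_inj; rewrite /= inordK.
- by move: h1; congr (u _ _ = w _ _); apply: val_inj; rewrite /= inordK.
- by move: h2; congr (u _ _ = w _ _); apply: val_inj; rewrite /= inordK.
- by move: h3; congr (u _ _ = w _ _); apply: val_inj; rewrite /= inordK.
Qed.

Lemma inord3 : inord 3 = ord_max :> 'I_4.
Proof. by apply: val_inj; rewrite /= inordK. Qed.

Lemma lamE : [/\ lam (inord 0) = ('X_0)%:F, lam (inord 1) = ('X_1)%:F,
  lam (inord 2) = ('X_(inord 2))%:F
  & lam (inord 3) = - (lam (inord 0) + lam (inord 1) + lam (inord 2))].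
Proof.
rewrite /lam !(tnth_nth 0) !inordK //=; split=> //.
by rewrite rmorphN !rmorphD.
Qed.

Definition lw (w : weight) : K := \sum_(i < 4) lam i *~ w 0 i.

Lemma lwD u w : lw (u + w) = lw u + lw w.
Proof. by rewrite -big_split; apply: eq_bigr => i _; rewrite mxE mulrzDr. Qed.

Lemma lwN w : lw (- w) = - lw w.
Proof. by rewrite -sumrN; apply: eq_bigr => i _; rewrite mxE mulrNz. Qed.

Lemma lw_const n : lw (const_mx n) = 0.
Proof.
by rewrite /lw sum4 !mxE; case: lamE => _ _ _ ->; rewrite -!mulrzDl addrN mul0rz.
Qed.

Lemma lw_cy w : lw (cy_rep w) = lw w.
Proof. by rewrite /cy_rep lwD lwN lw_const subr0. Qed.

(** After $\lambda_4$ is eliminated, the form has coefficients $w_i-w_4$ on the independent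
    variables $\lambda_1,\lambda_2,\lambda_3$; evaluation at the unit vectors extracts them. *)
Lemma lw_eq0 w : lw w = 0 -> w = const_mx (w 0 (inord 3)).
Proof.
rewrite /lw sum4; case: lamE => e0 e1 e2 ->; rewrite e0 e1 e2.
set a := w 0 _; set b := w 0 _; set c := w 0 _; set d := w 0 _ => h.
have {h} h : ('X_0 *~ (a - d) + 'X_1 *~ (b - d) + 'X_(inord 2) *~ (c - d) : {mpoly rat[3]}) = 0.
  apply/eqP; rewrite -tofrac_eq0 -h !rmorphD !rmorphMz; apply/eqP.
  by rewrite !mulrzBr !mulNrz !mulrzDl; ring.
have {}h (v : 'I_3 -> rat) :
    v 0%R *~ (a - d) + v 1%R *~ (b - d) + v (inord 2) *~ (c - d) = 0 :> rat.
  by have := congr1 (meval v) h; rewrite meval0 !mevalD !rmorphMz /= !mevalXU.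
have hd (i : 'I_3) := h (fun j => (j == i)%:R).
have := hd 0; have := hd 1; have := hd (inord 2).
rewrite -!val_eqE /= !inordK //= !mul0rz !addr0 !add0r => /eqP.
rewrite intr_eq0 => h2 /eqP; rewrite intr_eq0 => h1 /eqP; rewrite intr_eq0 => h0.
by apply: weightP; rewrite !mxE -/a -/b -/c -/d; lia.
Qed.

Lemma cy_rep_eq0 w : (cy_rep w == 0) = (lw w == 0).
Proof.
apply/eqP/eqP => [e|/lw_eq0 ->]; first by rewrite -lw_cy e /lw big1 // => i _; rewrite mxE.
by apply/rowP => i; rewrite !mxE subrr.
Qed.

(** Encodes the multiplicity of the trivial weight as a product over weights, so that its vanishing
    can be used multiplicatively. *)
Lemma wprod_delta (F : fieldType) (x : F) f :
  wprod (fun w => if w == 0 then x else 1) f = unz x ^ coeff 0 f.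
Proof.
elim/laurent_ind: f => [|w|f IHf|f g IHf IHg].
- by rewrite wprod0 coeff0.
- by rewrite wprod_mono coeff_mono; case: eqP => // _; rewrite unz_id // oner_neq0.
- by rewrite wprodN coeffN IHf -invr_expz.
by rewrite wprodD coeffD IHf IHg expfzDr // unz_neq0.
Qed.

Lemma cyE f : cy f = push cy_rep f. Proof. by []. Qed.

(** * The square roots as products over the half vertex *)

Section Solid.
Variables (pi : array3) (s : solid pi).

Lemma coeff_cy_Vchar w : lw w = 0 -> coeff w (cy (Vchar pi)) = 0.
Proof.
move=> w0; rewrite /cy coeff_sum big1 // => u _; rewrite coeffU.
case: eqP => [e|]; rewrite ?mulr0 // -e lw_cy in w0 *.
by rewrite (lw_eq0 w0) Vchar_const // mul0r.
Qed.

(** Once $t_1t_2t_3t_4=1$, the two halves of the vertex have the same coefficient at 0, and their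
    sum vanishes. *)
Lemma coeff_cy_half : coeff 0 (cy (vhalf (Zchar pi))) = 0.
Proof.
have := coeff_cy_Vchar (lw_const 0); rewrite -[const_mx 0]/(0 : weight).
rewrite Vchar_half !cyE rmorphD rmorphM /= coeffD.
have -> : push cy_rep tinv = 1.
  by rewrite push_mono; congr mono; apply/eqP; rewrite cy_rep_eq0 lw_const.
rewrite mulr1; move: (vhalf _) => v.
have -> : coeff 0 (push cy_rep (lbar v)) = coeff 0 (push cy_rep v).
  elim/laurent_ind: v => [|w|f IHf|f g IHf IHg].
  - by rewrite lbarE !raddf0.
  - by rewrite lbar_mono !push_mono !coeff_mono raddfN oppr_eq0.
  - by rewrite lbarN !raddfN /= IHf.
  by rewrite lbarD !raddfD /= IHf IHg.
by move=> /eqP; rewrite -mulr2n mulrn_eq0 => /eqP.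
Qed.

(** The weights of [cy (Vchar pi)] all have nonzero linear form, so [unz] changes no factor. *)
Lemma eT_Vchar : eT_neg (Vchar pi) = (wprod lw (Vchar pi))^-1.
Proof.
have -> : wprod lw (Vchar pi) = wprod lw (cy (Vchar pi)).
  by rewrite cyE wprod_push; apply: eq_wprod => w; rewrite /= lw_cy.
rewrite /wprod -prodfV; apply: eq_big_seq => w; rewrite mem_dom => nz.
have w0 : lw w != 0 by apply: contraNN nz => /eqP/coeff_cy_Vchar ->.
by rewrite -/(lw w) unz_id // -invr_expz.
Qed.

Lemma size_boxes : size (boxes pi) = psize pi.
Proof.
rewrite -sum1_size big_boxes /psize; apply: eq_bigr => b _.
by rewrite sum1_card card_ord.
Qed.

Lemma wprod_Zchar (F : fieldType) (h : weight -> F) :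
  wprod h (Zchar pi) = \prod_(a <- boxes pi) unz (h a).
Proof. by rewrite Zchar_boxes wprod_sum; apply: eq_bigr => a _; rewrite wprod_mono. Qed.

(** The dual half contributes the same product with every linear form negated; the resulting sign is
    $-1$ to the rank of the half vertex, which is $|\pi|$. *)
Lemma wprod_Vchar :
  wprod lw (Vchar pi) = (-1) ^+ psize pi * wprod lw (vhalf (Zchar pi)) ^+ 2.
Proof.
rewrite Vchar_half; set v := vhalf _; rewrite wprodD wprod_mulmono.
rewrite (eq_wprod (g := lw)) => [|w]; last by rewrite lwD lw_const addr0.
(* Where [lw w] vanishes, [unz (- lw w)] is 1 and not [- unz (lw w)]; [e] corrects the sign there.
   Its product is 1 because the trivial weight has total exponent 0. *)
pose e w : K := if cy_rep w == 0 then -1 else 1.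
have e0 w : e w != 0 by rewrite /e; case: ifP; rewrite ?oppr_eq0 oner_eq0.
have -> : wprod lw (lbar v) = wprod (fun=> -1) v * (wprod e v * wprod lw v).
  rewrite lbarE wprod_push /=.
  rewrite (@wprod_split _ _ (fun=> -1) (fun w => e w * unz (lw w)) v) => [|w].
    congr (_ * _); apply: wprod_split => w.
    by rewrite unz_id ?mulf_neq0 ?unz_neq0 // [unz (e w)]unz_id.
  rewrite /= lwN [unz (-1)]unz_id ?oppr_eq0 ?oner_eq0 //.
  rewrite [in RHS]unz_id ?mulf_neq0 ?unz_neq0 // /e cy_rep_eq0 /unz oppr_eq0.
  by case: ifP => _; rewrite ?mul1r ?mulN1r ?opprK.
have -> : wprod e v = 1.
  rewrite -(wprod_push (fun w => if w == 0 then -1 else 1) cy_rep) -cyE.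
  by rewrite wprod_delta coeff_cy_half expr0z.
(* The exponent is the value of the half vertex at $t=1$: the factor $1-t_3^{-1}$ kills the
   quadratic part and the number of boxes remains. *)
have -> : wprod (fun=> -1 : K) v = (-1) ^+ psize pi.
  rewrite /v /vhalf wprodB.
  have -> : lbar (cube 3) = lbar (cube 2) - lbar (cube 2) * mono (- delta_mx 0 (inord 2)).
    by rewrite cubeS mulrBr mulr1 lbarB lbarM lbar_tvar.
  rewrite mulrBr wprodB mulrA wprod_mulmono divff ?wprod_neq0 // divr1 wprod_Zchar.
  by rewrite big_const_seq count_predT size_boxes iter_mulr_1 unz_id // oppr_eq0 oner_eq0.
by rewrite mul1r expr2 mulrCA.
Qed.

(** The sign $(-1)^{|\pi|}$ in the definition of $\mathsf{w}_\pi$ cancels that of [wprod_Vchar],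
    which leaves an explicit square. *)
Lemma is_w_sign x : is_w pi x ->
  exists e : bool, x = (-1) ^+ e * wprod lw (- vhalf (Zchar pi)).
Proof.
rewrite /is_w eT_Vchar wprod_Vchar invfM -exprVn invrN1 mulrA -exprMn mulrNN mulr1.
rewrite expr1n mul1r -exprVn -wprodN => /eqP.
rewrite eqf_sqr => /orP[] /eqP ->; first by exists false; rewrite mul1r.
by exists true; rewrite mulN1r.
Qed.
End Solid.

(** * Calculus of specialization to the hyperplane *)

HB.instance Definition _ := GRing.RMorphism.copy hyp_restr
  (comp_mpoly [tuple 'X_0; 'X_1; - ('X_0 + 'X_1)] : {mpoly rat[3]} -> {mpoly rat[2]}).

Lemma ratr_fmorph (F : fieldType) (phi : {rmorphism rat -> F}) r : ratr r = phi r.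
Proof. by rewrite /ratr -{3}[r]divq_num_den fmorph_div !rmorph_int. Qed.

(** The embedding of constants, carrying a ring morphism structure; [ratr] is rewritten to it when
    that structure is needed. *)
Definition ratK n : rat -> {fraction {mpoly rat[n]}} := @tofrac _ \o @mpolyC n rat.
HB.instance Definition _ n := GRing.RMorphism.on (@ratK n).

Lemma ratrE n : (ratr : rat -> {fraction {mpoly rat[n]}}) =1 @ratK n.
Proof. by move=> r; apply: (ratr_fmorph (@ratK n)). Qed.

Lemma tofrac_addf (R : idomainType) (p q p' q' : R) : q != 0 -> q' != 0 ->
  p%:F / q%:F + p'%:F / q'%:F = (p * q' + p' * q)%:F / (q * q')%:F.
Proof. by move=> q0 q0'; rewrite addf_div ?tofrac_eq0 // !tofracM tofracD !tofracM. Qed.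

Lemma tofrac_mulf (R : idomainType) (p q p' q' : R) :
  p%:F / q%:F * (p'%:F / q'%:F) = (p * p')%:F / (q * q')%:F.
Proof. by rewrite mulf_div !tofracM. Qed.

Lemma tofrac_eqf (R : idomainType) (p q p' q' : R) : q != 0 -> q' != 0 ->
  (p%:F / q%:F == p'%:F / q'%:F) = (p * q' == p' * q).
Proof. by move=> q0 q0'; rewrite eqr_div ?tofrac_eq0 // -!tofracM tofrac_eq. Qed.

Lemma hyp_restr_neq0 p : hyp_restr p != 0 -> p != 0.
Proof. by apply: contraNneq => ->; rewrite rmorph0. Qed.

Lemma spec_tofrac p : specializes p%:F (hyp_restr p)%:F.
Proof. by exists p, 1; rewrite !rmorph1 !divr1; split=> //; exact: oner_neq0. Qed.

Lemma specD f g f' g' : specializes f g -> specializes f' g' -> specializes (f + f') (g + g').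
Proof.
move=> [p [q [q0 -> ->]]] [p' [q' [q0' -> ->]]]; exists (p * q' + p' * q), (q * q').
split; first by rewrite rmorphM mulf_neq0.
  by apply: tofrac_addf; apply: hyp_restr_neq0.
by rewrite tofrac_addf // (rmorphD hyp_restr) !(rmorphM hyp_restr).
Qed.

Lemma specM f g f' g' : specializes f g -> specializes f' g' -> specializes (f * f') (g * g').
Proof.
move=> [p [q [q0 -> ->]]] [p' [q' [q0' -> ->]]]; exists (p * p'), (q * q').
split; first by rewrite rmorphM mulf_neq0.
  exact: tofrac_mulf.
by rewrite tofrac_mulf !(rmorphM hyp_restr).
Qed.

Lemma specV f g : specializes f g -> g != 0 -> specializes f^-1 g^-1.
Proof.
move=> [p [q [q0 -> ->]]] g0; exists q, p; split; rewrite ?invf_div //.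
by apply: contraNneq g0 => ->; rewrite rmorph0 mul0r.
Qed.

Lemma spec_rat r : specializes (ratr r) (ratr r).
Proof.
by rewrite !ratrE; have := spec_tofrac r%:MP; rewrite /hyp_restr comp_mpolyC.
Qed.

Lemma spec1 : specializes 1 1.
Proof. by have := spec_tofrac 1; rewrite !rmorph1. Qed.

Lemma spec0 : specializes 0 0.
Proof. by have := spec_tofrac 0; rewrite !rmorph0. Qed.

Lemma specN f g : specializes f g -> specializes (- f) (- g).
Proof.
move=> s; rewrite -mulN1r -[- g]mulN1r; apply: specM => //.
by have := spec_tofrac (-1); rewrite !rmorphN !rmorph1.
Qed.

Lemma spec_sign (e : bool) : specializes ((-1) ^+ e) ((-1) ^+ e).
Proof. by case: e; [apply: specN; apply: spec1 | apply: spec1]. Qed.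

Lemma specX f g n : specializes f g -> specializes (f ^+ n) (g ^+ n).
Proof.
move=> s; elim: n => [|n IHn]; first exact: spec1.
by rewrite !exprS; apply: specM.
Qed.

Lemma spec_expz f g (n : int) : specializes f g -> g != 0 -> specializes (f ^ n) (g ^ n).
Proof.
case: n => n s g0; first exact: specX.
by rewrite NegzE -!invr_expz; apply: specV; [apply: specX | rewrite expf_neq0].
Qed.

Lemma spec_sum (I : Type) (r : seq I) f g : (forall i, specializes (f i) (g i)) ->
  specializes (\sum_(i <- r) f i) (\sum_(i <- r) g i).
Proof.
move=> h; elim: r => [|i r IHr]; first by rewrite !big_nil; apply: spec0.
by rewrite !big_cons; apply: specD.
Qed.

Lemma spec_prod (I : Type) (r : seq I) f g : (forall i, specializes (f i) (g i)) ->
  specializes (\prod_(i <- r) f i) (\prod_(i <- r) g i).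
Proof.
move=> h; elim: r => [|i r IHr]; first by rewrite !big_nil; apply: spec1.
by rewrite !big_cons; apply: specM.
Qed.

(** Equality of fractions is a polynomial identity after cross-multiplication, and [hyp_restr]
    preserves it. *)
Lemma spec_uniq f g g' : specializes f g -> specializes f g' -> g = g'.
Proof.
move=> [p [q [q0 -> ->]]] [p' [q' [q0' e ->]]].
apply/eqP; rewrite tofrac_eqf // -!(rmorphM hyp_restr); apply/eqP; congr hyp_restr.
by apply/eqP; rewrite -tofrac_eqf ?hyp_restr_neq0 // e.
Qed.

(** Negative exponents are harmless since [unz (g w)] never vanishes. Where [g w] is 0, the
    hypothesis asks [unz (h w)] to specialize to 1, so forms that vanish on the hyperplane must be
    split off first. *)
Lemma spec_wprod h g f : (forall w, specializes (unz (h w)) (unz (g w))) ->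
  specializes (wprod h f) (wprod g f).
Proof. by move=> s; apply: spec_prod => w; apply: spec_expz => //; apply: unz_neq0. Qed.

Lemma pspecM F G F' G' : poly_specializes F G -> poly_specializes F' G' ->
  poly_specializes (F * F') (G * G').
Proof. by move=> s s' i; rewrite !coefM; apply: spec_sum => j; apply: specM. Qed.

Lemma pspecD F G F' G' : poly_specializes F G -> poly_specializes F' G' ->
  poly_specializes (F + F') (G + G').
Proof. by move=> s s' i; rewrite !coefD; apply: specD. Qed.

Lemma pspecN F G : poly_specializes F G -> poly_specializes (- F) (- G).
Proof. by move=> s i; rewrite !coefN; apply: specN. Qed.

Lemma pspecC f g : specializes f g -> poly_specializes f%:P g%:P.
Proof. by move=> s i; rewrite !coefC; case: eqP => // _; apply: spec0. Qed.

Lemma pspec_prod (I : Type) (r : seq I) F G : (forall i, poly_specializes (F i) (G i)) ->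
  poly_specializes (\prod_(i <- r) F i) (\prod_(i <- r) G i).
Proof.
move=> h; elim: r => [|i r IHr]; first by rewrite !big_nil; apply: pspecC; apply: spec1.
by rewrite !big_cons; apply: pspecM.
Qed.

Lemma pspec_ratr d : poly_specializes (map_poly ratr d) (map_poly ratr d).
Proof.
move=> i; rewrite !coef_map_id0; first exact: spec_rat.
- by rewrite ratrE rmorph0.
by rewrite ratrE rmorph0.
Qed.

(** * Restriction of weights to lambda_1 + lambda_2 + lambda_3 = 0 *)

Definition lam0 (i : 'I_4) : K0 :=
  (hyp_restr (tnth [tuple 'X_0; 'X_1; 'X_(inord 2); - ('X_0 + 'X_1 + 'X_(inord 2))] i))%:F.

Lemma spec_lam i : specializes (lam i) (lam0 i).
Proof. exact: spec_tofrac. Qed.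

Lemma lam0E : [/\ lam0 (inord 0) = ('X_0)%:F, lam0 (inord 1) = ('X_1)%:F,
  lam0 (inord 2) = - (lam0 (inord 0) + lam0 (inord 1)) & lam0 (inord 3) = 0].
Proof.
have e0 : hyp_restr 'X_0 = 'X_0 by rewrite /hyp_restr comp_mpolyXU.
have e1 : hyp_restr 'X_1 = 'X_1 by rewrite /hyp_restr comp_mpolyXU.
have e2 : hyp_restr 'X_(inord 2) = - ('X_0 + 'X_1).
  by rewrite /hyp_restr comp_mpolyXU inordK.
rewrite /lam0 !(tnth_nth 0) !inordK //=; split; rewrite ?rmorphN ?rmorphD /= ?rmorphD /=.
- by rewrite e0.
- by rewrite e1.
- by rewrite e0 e1 e2 rmorphN rmorphD.
by rewrite e0 e1 e2 rmorphN rmorphD subrr oppr0.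
Qed.

Definition lw0 (w : weight) : K0 := \sum_(i < 4) lam0 i *~ w 0 i.

Lemma spec_lw w : specializes (lw w) (lw0 w).
Proof.
apply: spec_sum => i; case: (w 0 i) => n.
  rewrite -!pmulrn; elim: n => [|n IHn]; first exact: spec0.
  by rewrite !mulrS; apply: specD => //; apply: spec_lam.
rewrite NegzE !mulrNz; apply: specN; rewrite -!pmulrn.
elim: {n}(n.+1) => [|n IHn]; first exact: spec0.
by rewrite !mulrS; apply: specD => //; apply: spec_lam.
Qed.

Definition diag (w : weight) : bool :=
  (w 0 (inord 0) == w 0 (inord 1)) && (w 0 (inord 1) == w 0 (inord 2)).

(** For a weight $(n,n,n,m)$, the multiple of $\lambda_4$ that its linear form equals. *)
Definition height (w : weight) : int := w 0 (inord 3) - w 0 (inord 0).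

Lemma lw0_eq0 w : lw0 w = 0 -> diag w.
Proof.
rewrite /lw0 sum4; case: lam0E => e0 e1 -> ->; rewrite e0 e1 /diag.
set a := w 0 _; set b := w 0 _; set c := w 0 _; set d := w 0 _ => h.
have {h} h : ('X_0 *~ (a - c) + 'X_1 *~ (b - c) : {mpoly rat[2]}) = 0.
  apply/eqP; rewrite -tofrac_eq0 -h !rmorphD !rmorphMz; apply/eqP.
  by rewrite !mulrzBr !mulNrz !mulrzDl; ring.
have {}h (v : 'I_2 -> rat) : v 0%R *~ (a - c) + v 1%R *~ (b - c) = 0 :> rat.
  by have := congr1 (meval v) h; rewrite meval0 !mevalD !rmorphMz /= !mevalXU.
have hd (i : 'I_2) := h (fun j => (j == i)%:R).
have := hd 0; have := hd 1.
rewrite -!val_eqE /= !mul0rz !addr0 !add0r => /eqP.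
by rewrite intr_eq0 => h1 /eqP; rewrite intr_eq0 => h0; lia.
Qed.

(* The representative of [w] modulo (1,1,1,0) and (0,0,0,1). *)
Definition hyp_rep (w : weight) : weight :=
  \row_(i < 4) if i == inord 3 then 0 else w 0 i - w 0 (inord 2).

Lemma hyp_rep_is_zmod_morphism : zmod_morphism hyp_rep.
Proof. by move=> u v; apply/rowP => i; rewrite !mxE; case: eqP => // _; ring. Qed.

HB.instance Definition _ :=
  GRing.isZmodMorphism.Build _ _ hyp_rep hyp_rep_is_zmod_morphism.

Lemma push_lbar (phi : {additive weight -> weight}) f :
  push phi (lbar f) = lbar (push phi f).
Proof.
elim/laurent_ind: f => [|w|f IHf|f g IHf IHg].
- by rewrite !lbarE !raddf0.
- by rewrite lbar_mono !push_mono lbar_mono raddfN.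
- by rewrite lbarN !raddfN /= lbarN IHf.
by rewrite lbarD !raddfD /= lbarD IHf IHg.
Qed.

Lemma wprod_lbar_sqr (F : fieldType) (h : weight -> F) f :
  (forall w, h (- w) ^+ 2 = h w ^+ 2) -> wprod h (lbar f) ^+ 2 = wprod h f ^+ 2.
Proof. by move=> hN; rewrite lbarE wprod_push; apply: wprod_sqr. Qed.

(* On the hyperplane t1 t2 t3 = 1, and there (1-t1)(1-t2)(1-t3) is of the form
   [lbar p - p], so that the quadratic part of [vhalf Z] only contributes a sign. *)
Lemma wprod_vhalf (F : fieldType) (h : weight -> F) Z :
  (forall w, h (- w) ^+ 2 = h w ^+ 2) -> (forall w, h (hyp_rep w) = h w) ->
  wprod h (vhalf Z) ^+ 2 = wprod h Z ^+ 2.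
Proof.
move=> hN hr; rewrite /vhalf wprodB expr_div_n.
set Q := _ * _ * _; have -> : wprod h Q = wprod h (push hyp_rep Q).
  by rewrite wprod_push; apply: eq_wprod => w; rewrite /= hr.
rewrite rmorphM rmorphM /= !push_lbar.
set X := push _ Z; pose t i := push hyp_rep (tvar i).
have tE i : t i = mono (hyp_rep (delta_mx 0 (inord i))) by exact: push_mono.
have t012 : t 0%N * t 1%N * t 2%N = 1.
  rewrite !tE -!monoD; congr mono; apply: weightP; rewrite !mxE ?eqxx;
    by rewrite -?val_eqE /= ?inordK.
have tl i j k : t i * t j * t k = 1 -> lbar (t i) = t j * t k.
  move=> e; rewrite -[RHS]mul1r.
  have <- : t i * lbar (t i) = 1 by rewrite tE lbar_mono -monoD subrr.
  by rewrite mulrAC mulrA e mul1r.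
have l0 : lbar (t 0%N) = t 1%N * t 2%N by apply: tl.
have l1 : lbar (t 1%N) = t 0%N * t 2%N by apply: tl; rewrite [t 1%N * _]mulrC.
have l2 : lbar (t 2%N) = t 0%N * t 1%N by apply: tl; rewrite -mulrA mulrC.
pose p := t 0%N + t 1%N + t 2%N.
have -> : push hyp_rep (cube 3) = lbar p - p.
  rewrite cube3 /t1 /t2 /t3 -!/(tvar _) !rmorphM /= !rmorphB /= !rmorph1 -!/(t _).
  rewrite /p !lbarD l0 l1 l2; move: t012.
  move: (t 0%N) (t 1%N) (t 2%N) => x y z e.
  have -> : (1 - x) * (1 - y) * (1 - z) =
    1 - x * y * z - (x + y + z) + y * z + x * z + x * y by ring.
  by rewrite e; ring.
rewrite lbarB lbarK mulrBr wprodB.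
(* The product of [X] and [lbar X] is self-dual, so the two parts of the quadratic term are
   exchanged by [lbar]; as [h] is even up to sign, their products have equal squares. *)
have -> : X * lbar X * lbar p = lbar (X * lbar X * p).
  by rewrite !lbarM lbarK [lbar X * X]mulrC.
rewrite expr_div_n wprod_lbar_sqr // divff ?expf_neq0 ?wprod_neq0 //.
by rewrite divr1.
Qed.

Lemma sqr_sign (R : idomainType) (x y : R) : x ^+ 2 = y ^+ 2 ->
  exists e : bool, x = (-1) ^+ e * y.
Proof.
move/eqP; rewrite eqf_sqr => /orP[] /eqP ->; first by exists false; rewrite mul1r.
by exists true; rewrite mulN1r.
Qed.

(** The function [c] absorbs the discrepancy at the zeros of [h], where [unz] is not
    multiplicative. *)
Lemma wprod_split3 (F : fieldType) (h c g k m : weight -> F) f :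
  (forall w, unz (h w) * unz (c w) = unz (g w) * unz (k w) * unz (m w)) ->
  wprod h f * wprod c f = wprod g f * wprod k f * wprod m f.
Proof.
by move=> e; rewrite /wprod -!big_split; apply: eq_bigr => w _ /=; rewrite -!expfzMl e.
Qed.

Lemma unz_fmorph (F F' : fieldType) (phi : {rmorphism F -> F'}) x :
  unz (phi x) = phi (unz x).
Proof. by rewrite /unz fmorph_eq0; case: ifP => // _; rewrite rmorph1. Qed.

Lemma wprod_fmorph (F F' : fieldType) (phi : {rmorphism F -> F'}) h f :
  wprod (phi \o h) f = phi (wprod h f).
Proof. by rewrite rmorph_prod; apply: eq_bigr => w _; rewrite /= unz_fmorph fmorphXz. Qed.

Lemma diagN w : diag (- w) = diag w.
Proof. by rewrite /diag !mxE !eqr_opp. Qed.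

Lemma diag_hyp_rep w : diag (hyp_rep w) = diag w.
Proof.
rewrite /diag !mxE -!val_eqE /= !inordK //=.
by rewrite subrr !(inj_eq (addIr _)) [_ - _ == 0]subr_eq0.
Qed.

Lemma lw0_hyp_rep w : lw0 (hyp_rep w) = lw0 w.
Proof.
rewrite /lw0 !sum4; case: lam0E => _ _ -> ->.
rewrite !mxE -!val_eqE /= !inordK //= subrr.
move: (lam0 _) (lam0 _) => x y.
by rewrite !mul0rz !addr0 !mulrzBr mulNrz mulrzDl; ring.
Qed.

Lemma lw0N w : lw0 (- w) = - lw0 w.
Proof. by rewrite -sumrN; apply: eq_bigr => i _; rewrite mxE mulrNz. Qed.

Lemma lw_diag w : diag w -> lw w = (height w)%:~R * lam (inord 3).
Proof.
case/andP => /eqP e0 /eqP e1; rewrite /lw /height sum4 e0 e1.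
case: lamE => _ _ _ ->; move: (lam _) (lam _) (lam _) => x y z.
rewrite mulrzl mulrzBr !mulNrz !mulrzDl.
by ring.
Qed.

Lemma lam3_neq0 : lam (inord 3) != 0.
Proof.
apply/eqP => e; suff /lw_eq0 : lw (delta_mx 0 (inord 3)) = 0.
  move/rowP/(_ (inord 0)); rewrite !mxE !eqxx /= -!val_eqE /= !inordK //.
rewrite /lw sum4 e !mxE !eqxx -!val_eqE /= !inordK //=.
by rewrite !mulr0z !addr0.
Qed.

(** * The constant omega and the specialization of $L\,\mathsf{w}$ *)

(** Absolute values make [omega] positive, the discarded signs going into the overall sign. At
    height 0 the value 0 is read as 1 by [wprod]. *)
Definition nfac (w : weight) : rat := if diag w then `|height w|%:~R else 1.

Definition omega (B : seq weight) : rat := wprod nfac (- vhalf (char B)).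

Lemma omega_gt0 B : 0 < omega B.
Proof.
rewrite /omega /wprod; elim/big_ind: _ => //= [x y|w _]; first exact: mulr_gt0.
apply: exprz_gt0; rewrite /unz; case: ifP => // h.
by rewrite lt0r h /nfac; case: ifP => // _; rewrite ler0z.
Qed.

Definition diag_prod (d : {poly rat}) (B : seq weight) : {poly rat} :=
  \prod_(a <- B) if diag a then d - (height a)%:~R else 1.

Lemma Lprod_boxes (R : comNzRingType) (la d : 'I_4 -> R) pi :
  Lprod la d pi = \prod_(a <- boxes pi) \sum_(i < 4) (d i + (a 0 i)%:~R) * la i.
Proof.
rewrite big_boxes; apply: eq_bigr => b _; apply: eq_bigr => l _.
by apply: eq_bigr => i _; rewrite mxE -pmulrn.
Qed.

Lemma Lw_boxes d pi x : Lw d pi x =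
  (\prod_(a <- boxes pi) ((lw a)%:P - map_poly ratr d * (lam (inord 3))%:P)) * x%:P.
Proof.
rewrite /Lw Lprod_boxes; congr (_ * _); apply: eq_bigr => a _.
under eq_bigr do rewrite mulrDl.
rewrite big_split /= addrC; congr (_ + _).
  rewrite /lw rmorph_sum; apply: eq_bigr => i _ /=.
  by rewrite rmorphMz mulrzl.
rewrite (bigD1 ord_max) //= ?eqxx big1 ?addr0 => [|i /negPf ->]; last by rewrite mul0r.
by rewrite inord3 mulNr.
Qed.

(** Here [l] collects the powers of $\lambda_4$, which occur once in $L$ and once, inverted and up
    to sign, in $\mathsf{w}$. They must cancel before restriction, where $\lambda_4$ becomes 0. *)
Lemma assemble_factors (F : fieldType) (Pd Pn : {poly F}) (l s B C : F) (e : bool) :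
  l != 0 ->
  Pd * l%:P * Pn * (s * (B * ((-1) ^+ e * l) * C)^-1)%:P =
  Pd * Pn * (s * (-1) ^+ e * (B^-1 * C^-1))%:P.
Proof.
move=> l0; rewrite !invfM invr_sign.
have -> : Pd * l%:P * Pn * (s * (B^-1 * ((-1) ^+ e * l^-1) * C^-1))%:P =
  Pd * Pn * (l%:P * (s * (B^-1 * ((-1) ^+ e * l^-1) * C^-1))%:P) by ring.
rewrite -polyCM; congr (_ * _%:P); move: (_ ^+ e) B^-1 C^-1 => E b c.
have -> : l * (s * (b * (E * l^-1) * c)) = (l / l) * (s * E * (b * c)) by ring.
by rewrite divff ?mul1r.
Qed.

(** After restriction, the off-diagonal factors of $L$ and of $\mathsf{w}$ give the same [W] up to
    sign and cancel, so only rational data remain. *)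
Lemma assemble_limit (F : fieldType) (phi : {rmorphism rat -> F}) (p : {poly rat})
    (W : F) b (s1 s2 s3 : bool) : W != 0 ->
  map_poly phi p * W%:P * ((-1) ^+ s1 * (-1) ^+ s2 * ((phi b)^-1 * ((-1) ^+ s3 * W)^-1))%:P
  = map_poly phi (((-1) ^+ (s1 (+) s2 (+) s3) * b^-1) *: p).
Proof.
move=> W0; rewrite map_polyZ (rmorphM phi) (rmorph_sign phi) fmorphV !signr_addb -mul_polyC.
rewrite invfM invr_sign; move: ((-1) ^+ s1) ((-1) ^+ s2) ((-1) ^+ s3) => x y z.
have -> : map_poly phi p * W%:P * (x * y * ((phi b)^-1 * (z * W^-1)))%:P =
  W%:P * (x * y * ((phi b)^-1 * (z * W^-1)))%:P * map_poly phi p by ring.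
rewrite -polyCM; congr (_%:P * _).
have -> : W * (x * y * ((phi b)^-1 * (z * W^-1))) = (W / W) * (x * y * z / phi b) by ring.
by rewrite divff // mul1r.
Qed.

Lemma unz1 (F : fieldType) : unz (1 : F) = 1.
Proof. by rewrite unz_id ?oner_eq0. Qed.

(** If [x] is 0, then [d] holds and [h] is 0, yet the right-hand side keeps a factor [l]; the second
    factor on the left supplies it. *)
Lemma unz_diag (F : fieldType) (d : bool) (h l x : F) :
  l != 0 -> (d -> x = h * l) -> (~~ d -> x != 0) ->
  unz x * unz (if x == 0 then l else 1) =
  unz (if d then h else 1) * unz (if d then l else 1) * unz (if d then 1 else x).
Proof.
case: d => l0 /= hd nd.
  rewrite hd // mulf_eq0 (negPf l0) orbF unz1 mulr1.
  case: eqP => [->|/eqP h0]; first by rewrite mul0r /unz eqxx.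
  by rewrite unz1 mulr1 !unz_id ?mulf_neq0.
by rewrite (negPf (nd isT)) !unz1 mulr1 !mul1r.
Qed.

Lemma split_factor (F : fieldType) (b : bool) (D : {poly F}) (h l x : F) :
  (b -> x = h * l) -> x%:P - D * l%:P =
  (if b then h%:P - D else 1) * (if b then l else 1)%:P * (if b then 1 else x%:P - D * l%:P).
Proof. by case: b => [->|_]; rewrite // ?mul1r // mulr1 mulrBl -polyCM. Qed.

Lemma diag_prod_opp (d : {poly rat}) B :
  \prod_(a <- B) (if diag a then (height a)%:~R - d else 1) =
  (-1) ^+ odd (count diag B) *: diag_prod d B.
Proof.
rewrite signr_odd /diag_prod; elim: B => [|a B IHB]; first by rewrite !big_nil scale1r.
rewrite !big_cons IHB /=; case: (diag a); last by rewrite !mul1r.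
by rewrite exprS mulN1r scaleNr -scalerAr -opprB mulNr scalerN.
Qed.

Section Decomposition.
Variables (pi : array3) (s : solid pi).

(* [lw w] is the product of the next three functions at [w], up to the zeros at the
   weights (n,n,n,n). *)
Definition diag_scale (w : weight) : rat := if diag w then (height w)%:~R else 1.
Definition diag_lam (w : weight) : K := if diag w then lam (inord 3) else 1.
Definition offdiag_lw (w : weight) : K := if diag w then 1 else lw w.
Definition offdiag_lw0 (w : weight) : K0 := if diag w then 1 else lw0 w.

Lemma lw_eq0_diag w : lw w = 0 -> diag w.
Proof. by move/lw_eq0 ->; rewrite /diag !mxE !eqxx. Qed.

Lemma wprod_lw_factor :
  wprod lw (vhalf (Zchar pi)) = ratK 3 (wprod diag_scale (vhalf (Zchar pi)))
    * wprod diag_lam (vhalf (Zchar pi)) * wprod offdiag_lw (vhalf (Zchar pi)).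
Proof.
set v := vhalf _.
(* The factorization is off by $\lambda_4$ exactly at the weights $(n,n,n,n)$, whose total exponent
   in the half vertex is 0. *)
have c1 : wprod ((fun w => if w == 0 then lam (inord 3) else 1) \o cy_rep) v = 1.
  by rewrite -wprod_push -cyE wprod_delta coeff_cy_half // expr0z.
rewrite -[LHS]mulr1 -[X in _ * X]c1 -wprod_fmorph; apply: wprod_split3 => w.
rewrite /= cy_rep_eq0.
have -> : ratK 3 (diag_scale w) = if diag w then (height w)%:~R else 1.
  by rewrite /diag_scale; case: ifP => _; rewrite ?rmorph_int ?rmorph1.
apply: unz_diag => [||nd]; first exact: lam3_neq0.
- exact: lw_diag.
by apply: contraNneq nd => /lw_eq0_diag.
Qed.

Lemma diag_lam_neq0 w : diag_lam w != 0.
Proof. by rewrite /diag_lam; case: ifP => _; [exact: lam3_neq0 | exact: oner_neq0]. Qed.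

(** [diag_lam] is even and constant on the classes of [hyp_rep], so [wprod_vhalf] reduces the power
    of $\lambda_4$ to the diagonal boxes. *)
Lemma wprod_diag_lam : exists e : bool,
  wprod diag_lam (vhalf (Zchar pi)) = (-1) ^+ e * \prod_(a <- boxes pi) diag_lam a.
Proof.
have [w|w|e ->] := sqr_sign (@wprod_vhalf _ diag_lam (Zchar pi) _ _).
- by rewrite /diag_lam diagN.
- by rewrite /diag_lam diag_hyp_rep.
exists e; rewrite wprod_Zchar; congr (_ * _); apply: eq_bigr => a _.
by rewrite (unz_id (diag_lam_neq0 a)).
Qed.

Lemma offdiag_lw0_neq0 w : offdiag_lw0 w != 0.
Proof.
rewrite /offdiag_lw0; case: (boolP (diag w)) => [_|dw]; first exact: oner_neq0.
by apply: contraNneq dw => /lw0_eq0.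
Qed.

(** The same reduction, made after restriction because only [lw0], and not [lw], is constant on the
    classes of [hyp_rep]. *)
Lemma wprod_offdiag_lw0 : exists e : bool,
  wprod offdiag_lw0 (vhalf (Zchar pi)) = (-1) ^+ e * \prod_(a <- boxes pi) offdiag_lw0 a.
Proof.
have [w|w|e ->] := sqr_sign (@wprod_vhalf _ offdiag_lw0 (Zchar pi) _ _).
- by rewrite /offdiag_lw0 diagN; case: ifP => // _; rewrite lw0N sqrrN.
- by rewrite /offdiag_lw0 diag_hyp_rep lw0_hyp_rep.
exists e; rewrite wprod_Zchar; congr (_ * _); apply: eq_bigr => a _.
by rewrite (unz_id (offdiag_lw0_neq0 a)).
Qed.

(** The height varies within a class of [hyp_rep], so [wprod_vhalf] does not apply here; this
    rational factor survives as [omega]. *)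
Lemma wprod_diag_scale : exists e : bool,
  wprod diag_scale (vhalf (Zchar pi)) = (-1) ^+ e * wprod nfac (vhalf (Zchar pi)).
Proof.
apply: sqr_sign; apply: wprod_sqr => w; rewrite /diag_scale /nfac.
by case: ifP => // _; rewrite intr_norm real_normK ?num_real.
Qed.

Lemma spec_offdiag_lw f : specializes (wprod offdiag_lw f) (wprod offdiag_lw0 f).
Proof.
apply: spec_wprod => w; have := offdiag_lw0_neq0 w; rewrite /offdiag_lw /offdiag_lw0.
case: (boolP (diag w)) => [_ _|dw n0]; first by rewrite !unz1; apply: spec1.
have lw_n0 : lw w != 0 by apply: contraNneq dw => /lw_eq0_diag.
by rewrite (unz_id n0) (unz_id lw_n0); apply: spec_lw.
Qed.

(* One sign serves all [d]: below it is determined from d = 6 and used for d = 'X. *)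
Lemma Lw_specializes x : is_w pi x -> exists e : bool, forall d : {poly rat},
  poly_specializes (Lw d pi x)
    (map_poly ratr (((-1) ^+ e * omega (boxes pi)) *: diag_prod d (boxes pi))).
Proof.
move=> wx; have [e1 ex] := is_w_sign s wx.
have [e2 eL] := wprod_diag_lam; have [e3 eC] := wprod_offdiag_lw0.
have [e4 eB] := wprod_diag_scale.
(* The sign from turning [height a - d] into [d - height a] at each diagonal box. *)
pose e5 := odd (count diag (boxes pi)).
exists (e1 (+) e2 (+) e3 (+) e4 (+) e5) => d.
pose Pd := \prod_(a <- boxes pi)
  if diag a then (ratr (height a)%:~R)%:P - map_poly ratr d else 1 : {poly K}.
pose Pn := \prod_(a <- boxes pi)
  if diag a then 1 else (lw a)%:P - map_poly ratr d * (lam (inord 3))%:P : {poly K}.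
pose l := \prod_(a <- boxes pi) diag_lam a.
have l0 : l != 0.
  by rewrite prodf_seq_neq0; apply/allP => a _; apply: diag_lam_neq0.
(* The factor of $L$ at a diagonal box is $\lambda_4$ times (height minus $d$): [Pd] keeps the
   latter, [l] the former, and [Pn] the off-diagonal factors. *)
have -> : Lw d pi x = Pd * l%:P * Pn * x%:P.
  rewrite Lw_boxes rmorph_prod -!big_split /=; congr (_ * _).
  apply: eq_bigr => a _; apply: split_factor => da.
  by rewrite (lw_diag da) ratrE rmorph_int.
rewrite {}ex wprodN wprod_lw_factor eL assemble_factors //.
set W := \prod_(a <- boxes pi) offdiag_lw0 a in eC.
have W0 : W != 0 by rewrite prodf_seq_neq0; apply/allP => a _; apply: offdiag_lw0_neq0.
set b := wprod diag_scale _ in eB *.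
pose p := \prod_(a <- boxes pi) if diag a then (height a)%:~R - d else 1.
have -> : map_poly ratr (((-1) ^+ (e1 (+) e2 (+) e3 (+) e4 (+) e5) * omega (boxes pi))
      *: diag_prod d (boxes pi)) =
   map_poly (ratK 2) p * W%:P * ((-1) ^+ e1 * (-1) ^+ e2
      * ((ratK 2 b)^-1 * ((-1) ^+ e3 * W)^-1))%:P.
  rewrite assemble_limit // (eq_map_poly (@ratrE 2)); congr (map_poly _ _).
  have -> : p = (-1) ^+ e5 *: diag_prod d (boxes pi).
    exact: diag_prod_opp.
  rewrite scalerA; congr (_ *: _).
  rewrite eB invfM invr_sign /omega -Zchar_boxes wprodN !signr_addb.
  by move: (_ ^+ e1) (_ ^+ e2) (_ ^+ e3) (_ ^+ e4) (_ ^+ e5) => *; ring.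
apply: pspecM; first apply: pspecM.
- rewrite rmorph_prod; apply: pspec_prod => a; case: ifP => _; last first.
    by rewrite rmorph1; apply: pspecC; apply: spec1.
  rewrite (rmorphB (map_poly (ratK 2))) (rmorph_int (map_poly (ratK 2))) /=.
  rewrite [X in poly_specializes _ (_ - X)](_ : _ = map_poly ratr d); last first.
    by apply: eq_map_poly => r; rewrite ratrE.
  apply: pspecD; last by apply: pspecN; apply: pspec_ratr.
  have -> : (height a)%:~R = (ratr (height a)%:~R)%:P :> {poly K0}.
    by rewrite ratrE !rmorph_int.
  by apply: pspecC; apply: spec_rat.
- rewrite rmorph_prod; apply: pspec_prod => a; rewrite /offdiag_lw0 /=; case: ifP => _.
    by apply: pspecC; apply: spec1.
  have [_ _ _ l3] := lam0E.
  (* Since $\lambda_4$ restricts to 0, the term with $d$ of an off-diagonal factor disappears in the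
     limit. *)
  have -> : (lw0 a)%:P = (lw0 a)%:P - map_poly ratr d * (lam0 (inord 3))%:P.
    by rewrite l3 polyC0 mulr0 subr0.
  apply: pspecD; first by apply: pspecC; apply: spec_lw.
  apply: pspecN; apply: pspecM; first exact: pspec_ratr.
  by apply: pspecC; apply: spec_lam.
apply: pspecC; apply: specM; first by apply: specM; apply: spec_sign.
apply: specM.
  rewrite -!ratrE; apply: specV; first exact: spec_rat.
  by rewrite ratrE fmorph_eq0 wprod_neq0.
by rewrite -eC; apply: specV; [apply: spec_offdiag_lw | apply: wprod_neq0].
Qed.
End Decomposition.

Lemma pspec_prop_a d pi x G : poly_specializes (Lw d pi x) G -> prop_a d pi x.
Proof. by move=> h i; have [p [q [q0 e _]]] := h i; exists p, q. Qed.

(** * Solid partitions with $\pi_{222}=0$ *)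

Lemma bweight_eq i j k l i' j' k' l' :
  (bweight (i, j, k) l == bweight (i', j', k') l') = [&& i == i', j == j', k == k' & l == l'].
Proof. by rewrite bweightE !mxE !(tnth_nth 0%N) /= !inordK //= !eqz_nat. Qed.

Lemma diag_bweight i j k l : diag (bweight (i, j, k) l) = (i == j) && (j == k).
Proof. by rewrite /diag !mxE !(tnth_nth 0%N) /= !inordK //= !eqz_nat. Qed.

Lemma height_bweight i j k l : height (bweight (i, j, k) l) = l%:Z - i%:Z.
Proof. by rewrite /height !mxE !(tnth_nth 0%N) /= !inordK. Qed.

(** A diagonal box lies over some $(i,i,i)$; by monotonicity $i>0$ would force a box over
    [(1, 1, 1)]. *)
Lemma diag_prod_corner d pi : solid pi -> pi (1, 1, 1)%N = 0%N ->
  diag_prod d (boxes pi) = \prod_(l < pi (0, 0, 0)%N) (d - l%:R).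
Proof.
move=> s p1; rewrite /diag_prod big_boxes (bigID (pred1 (0, 0, 0)%N)) /=.
rewrite [X in _ * X]big1 ?mulr1 => [|[[i j] k] b0]; last first.
  apply: big1 => l _; rewrite diag_bweight; case: ifP => // /andP[/eqP ij /eqP jk].
  have i1 : (0 < i)%N by rewrite lt0n; apply: contraNneq b0 => i0; rewrite -jk -ij i0.
  have := solid_mono s i1 i1 i1; rewrite p1 leqn0 => /eqP p0.
  by case: l => l; rewrite -jk -ij p0.
have corner : \prod_(l < pi (0, 0, 0)%N) (if diag (bweight (0, 0, 0)%N l)
    then d - (height (bweight (0, 0, 0)%N l))%:~R else 1)
    = \prod_(l < pi (0, 0, 0)%N) (d - l%:R).
  by apply: eq_bigr => l _; rewrite diag_bweight height_bweight subr0 -pmulrn.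
(* For the empty partition the corner is outside the support, and both products are empty. *)
have [m|nm] := boolP ((0, 0, 0)%N \in finsupp pi).
  by rewrite -big_filter filter_pred1_uniq ?fset_uniq // big_seq1 corner.
rewrite big1_seq => [|b /andP[/eqP -> bm]]; last by rewrite bm in nm.
by move: nm; rewrite mem_finsupp negbK => /eqP ->; rewrite big_ord0.
Qed.

Lemma c_sign_intro d pi x (e : bool) om :
  poly_specializes (Lw d pi x)
    (map_poly ratr (((-1) ^+ e * om) *: \prod_(l < pi (0, 0, 0)%N) (d - l%:R))) ->
  c_sign d pi x om.
Proof.
rewrite /c_sign /c_rhs -(signr_odd _ (psize pi)); case: (odd _); case: e => h.
- by left.
- by right; rewrite expr1 mulN1r scaleNr opprK; move: h; rewrite expr0 mul1r.
- by right; rewrite expr0 mul1r -scaleNr; move: h; rewrite expr1 mulN1r.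
by left.
Qed.

(** The common source of parts (1) and (3), whose partitions all satisfy $\pi_{222}=0$. *)
Lemma corner_props d pi x : solid pi -> pi (1, 1, 1)%N = 0%N -> is_w pi x ->
  [/\ prop_a d pi x, prop_b d pi x & c_sign d pi x (omega (boxes pi))].
Proof.
move=> s p1 /(Lw_specializes s)[e /(_ d) h]; split.
- exact: pspec_prop_a h.
- by eexists; apply: h.
by apply: (@c_sign_intro _ _ _ e); rewrite -diag_prod_corner.
Qed.

(** * The listed characters *)

(** With natural exponents, products and coefficients of the listed characters reduce to arithmetic
    and comparison of naturals. *)
Definition bmono i j k l : laurent := mono (bweight (i, j, k) l).

Lemma bmonoM i j k l i' j' k' l' : bmono i j k l * bmono i' j' k' l' =
  bmono (i + i') (j + j') (k + k') (l + l').
Proof.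
rewrite -monoD; congr mono; apply/eqP; rewrite bweightE !mxE.
by rewrite !(tnth_nth 0%N) /= !inordK //= -!PoszD !eqxx.
Qed.

Lemma bmono1 : 1 = bmono 0 0 0 0.
Proof.
by rewrite -[LHS]/(mono 0); congr mono; apply/eqP; rewrite bweightE !mxE !eqxx.
Qed.

Lemma bmono_t : [/\ t1 = bmono 1 0 0 0, t2 = bmono 0 1 0 0, t3 = bmono 0 0 1 0
  & t4 = bmono 0 0 0 1].
Proof.
by split; congr mono; apply/eqP; rewrite bweightE !mxE -!val_eqE /= !inordK.
Qed.

Lemma coeff_bmono i j k l i' j' k' l' :
  coeff (bweight (i', j', k') l') (bmono i j k l) = [&& i == i', j == j', k == k' & l == l']%:R.
Proof. by rewrite coeff_mono bweight_eq. Qed.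

Lemma coeff_listed f : f \in listed -> coeff (bweight (1, 1, 1)%N 0) f = 0.
Proof.
have [e1 e2 e3 e4] := bmono_t; rewrite /listed bmono1 e1 e2 e3 e4 !inE !exprS !expr0.
rewrite bmono1 !bmonoM !addn0 !add0n.
by do !case/orP; move=> /eqP->; rewrite !coeffD !coeff_bmono.
Qed.

(** A nonempty column over [(1, 1, 1)] would contain its lowest box $t_1t_2t_3$, which occurs in
    none of the listed characters. *)
Lemma listed_corner pi : solid pi -> Zchar pi \in listed -> pi (1, 1, 1)%N = 0%N.
Proof.
move=> s /coeff_listed; have [uB _ _] := boxes_ideal s.
by rewrite Zchar_boxes coeff_char // mem_boxes; case: (pi _).
Qed.

(** * Solid partitions with pi_111 = 1 *)

Section HeightOne.
Variables (pi : array3) (s : solid pi) (h1 : pi (0, 0, 0)%N = 1%N).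

Definition flat (w : weight) : weight := \row_(i < 4) if i == inord 3 then 0 else w 0 i.

Lemma flat_is_zmod_morphism : zmod_morphism flat.
Proof. by move=> u v; apply/rowP => i; rewrite !mxE; case: eqP. Qed.

HB.instance Definition _ := GRing.isZmodMorphism.Build _ _ flat flat_is_zmod_morphism.

Definition cube_weight (n : int) : weight := \row_(i < 4) if i == inord 3 then 0 else n.

Lemma boxes_flat a : a \in boxes pi -> a 0 (inord 3) = 0.
Proof.
move=> ain; have [i [j [k [l ea]]]] := boxesP ain; move: ain; rewrite ea mem_boxes => lt.
have := solid_mono s (leq0n i) (leq0n j) (leq0n k); rewrite h1.
rewrite !mxE (tnth_nth 0%N) /= inordK //=; lia.
Qed.

(** By [vertex3E], at height one this is the Donaldson-Thomas vertex character of affine three-space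
    for the three-dimensional diagram of [pi]. *)
Definition vertex3 : laurent := vhalf (Zchar pi) - lbar (Zchar pi) * tinv3.

Lemma vertex3E : vertex3 =
  Zchar pi - lbar (Zchar pi) * tinv3 + Zchar pi * lbar (Zchar pi) * cube 3 * tinv3.
Proof. by rewrite /vertex3 /vhalf lbar_cube3; ring. Qed.

Lemma tinv3E : tinv3 = mono (cube_weight (-1)).
Proof.
rewrite /tinv3 /tinv1 -!monoD; congr mono; apply: weightP; rewrite !mxE ?eqxx /=;
  by rewrite -?val_eqE /= ?inordK.
Qed.

(** Antisymmetric duality of the three-dimensional vertex; it exchanges the coefficients at
    $(n,n,n,0)$ and $(-1-n,-1-n,-1-n,0)$ up to sign. *)
Lemma lbar_vertex3 : lbar vertex3 * tinv3 = - vertex3.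
Proof.
have e : lbar tinv3 * tinv3 = 1.
  by rewrite tinv3E lbar_mono -monoD addNr.
rewrite vertex3E; have := lbar_cube3; move: tinv3 e => y e c3.
rewrite lbarD lbarB !lbarM !lbarK c3; move: (lbar y) (Zchar pi) (cube 3) e => x z c e.
move: (lbar z) => zb; have -> : (zb - z * x + zb * z * - (c * y) * x) * y =
  zb * y - z * (x * y) - zb * z * c * (x * y) * y by ring.
by rewrite e; ring.
Qed.

Lemma ltn3 (i : 'I_4) : i != inord 3 -> (i < 3)%N.
Proof.
move=> ni; rewrite ltn_neqAle -ltnS ltn_ord andbT.
by apply: contraNneq ni => e3; rewrite -val_eqE /= e3 inordK.
Qed.

(** As for [Vchar_const], with three factors: for $n\geq0$ the quadratic term counts the box
    $(n,n,n,0)$ with sign $(-1)^3$ and cancels $Z$; duality gives the negative weights. *)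
Lemma coeff_vertex3 n : coeff (cube_weight n) vertex3 = 0.
Proof.
have [uB B0 Bd] := boxes_ideal s.
have nonneg (m : nat) : coeff (cube_weight m) vertex3 = 0.
  rewrite vertex3E coeffD coeffB tinv3E !coeff_mulmono coeff_lbar Zchar_boxes !coeff_char //.
  have -> : (- (cube_weight m - cube_weight (-1)) \in boxes pi) = false.
    apply/negP => /(B0 _ (inord 0)); rewrite !mxE -!val_eqE /= !inordK //=; lia.
  rewrite coeff_cube; first last.
  - move=> i; rewrite !mxE; case: (eqVneq i (inord 3)) => [->|ni]; first by rewrite inordK.
    by rewrite ltn3 //; lia.
  - by [].
  - exact: boxes_ideal.
  set Q := \sum_(a <- _) _.
  have -> : Q = \sum_(a <- boxes pi) coeff (cube_weight m) (mono a).
    apply: eq_big_seq => a ain; rewrite coeff_mono; congr (_ %:R); congr nat_of_bool.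
    have a3 := boxes_flat ain.
    apply/forallP/eqP => [h|-> i].
      apply/rowP => i; have := h i; rewrite !mxE; case: (eqVneq i (inord 3)) => [-> _|ni].
        by rewrite a3.
      by rewrite ltn3 // => /eqP ->; lia.
    rewrite !mxE; case: (eqVneq i (inord 3)) => [->|ni]; first by rewrite inordK.
    by rewrite ltn3 //; lia.
  by rewrite -coeff_sum coeff_char //; case: (_ \in _).
case: n => [m|m]; first exact: nonneg.
rewrite -[vertex3]opprK -lbar_vertex3 coeffN tinv3E coeff_mulmono coeff_lbar.
have -> : - (cube_weight (Negz m) - cube_weight (-1)) = cube_weight m.
  by apply/rowP => i; rewrite !mxE; case: eqP => _; lia.
by rewrite nonneg oppr0.
Qed.

Lemma dom_vertex3 w : w \in dom vertex3 -> w 0 (inord 3) = 0.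
Proof.
have -> : vertex3 = push flat vertex3; last first.
  by case/mem_dom_push => u _ <-; rewrite mxE eqxx.
have fZ : push flat (Zchar pi) = Zchar pi.
  rewrite Zchar_boxes rmorph_sum; apply: eq_big_seq => a ain /=; rewrite push_mono.
  congr mono; apply/rowP => i; rewrite mxE; case: eqP => // ->.
  by rewrite boxes_flat.
have ft i : (i < 3)%N -> push flat (tvar i) = tvar i.
  move=> i3; rewrite push_mono; congr mono; apply/rowP => j; rewrite !mxE eqxx /=.
  case: eqP => // ->; case: eqP => // /(congr1 val); rewrite /= !inordK; lia.
have f3 : push flat tinv3 = tinv3.
  by rewrite tinv3E push_mono; congr mono; apply/rowP => j; rewrite !mxE; case: eqP.
have fc : push flat (cube 3) = cube 3.
  by rewrite cube3 !(rmorphB, rmorphM) /= rmorph1 !ft.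
rewrite vertex3E; move: tinv3 (cube 3) f3 fc => y c f3 fc.
by rewrite !(rmorphD, rmorphN, rmorphM) /= push_lbar fZ f3 fc.
Qed.

Lemma wprod_vertex3 : wprod nfac vertex3 = 1.
Proof.
apply: wprod1 => w wd; have w3 := dom_vertex3 wd.
suff /negPf dw : ~~ diag w by rewrite /nfac dw unz1.
apply: contraL wd => /andP[/eqP e0 /eqP e1]; rewrite mem_dom negbK.
have -> : w = cube_weight (w 0 (inord 2)); last by rewrite coeff_vertex3.
by apply: weightP; rewrite !mxE -?val_eqE /= ?inordK // e0.
Qed.

(** The half vertex is [vertex3], which contributes 1, plus the dual of $Z$ over $t_1t_2t_3$. In the
    latter a box $(i,i,i,0)$ yields a weight of height $1+i$, which is also its factor in
    [diag_prod] at $d=1$. *)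
Lemma omega_height1 : omega (boxes pi) *: diag_prod 1 (boxes pi) = 1.
Proof.
have -> : diag_prod 1 (boxes pi) = (wprod nfac (vhalf (Zchar pi)))%:P.
  rewrite -[vhalf _](subrK (lbar (Zchar pi) * tinv3)) wprodD wprod_vertex3 mul1r.
  rewrite tinv3E wprod_mulmono lbarE wprod_push wprod_Zchar rmorph_prod.
  apply: eq_big_seq => a ain /=; rewrite /nfac.
  have -> : diag (- a + cube_weight (-1)) = diag a.
    by rewrite /diag !mxE -!val_eqE /= !inordK // !(inj_eq (addIr _)) !eqr_opp.
  case: ifP => _; last by rewrite unz1.
  have [_ B0 _] := boxes_ideal s.
  have a0 := B0 _ (inord 0) ain; have a3 := boxes_flat ain.
  have -> : height (- a + cube_weight (-1)) = 1 - height a.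
    rewrite /height !mxE -!val_eqE /= !inordK //=. ring.
  have p : 0 < 1 - height a by rewrite /height a3; lia.
  rewrite gtr0_norm // unz_id ?intr_eq0 ?gt_eqF //.
  by rewrite (rmorph_int (@polyC rat)) [RHS]intrB.
by rewrite /omega -Zchar_boxes wprodN -mul_polyC -polyCM mulVf ?wprod_neq0.
Qed.

Lemma height1_props x : is_w pi x ->
  [/\ prop_a 1 pi x, prop_b 1 pi x & c_sign 1 pi x 1].
Proof.
move=> /(Lw_specializes s)[e /(_ 1) h]; split.
- exact: pspec_prop_a h.
- by eexists; apply: h.
apply: (@c_sign_intro _ _ _ e); move: h; rewrite h1 big_ord1 subr0 mulr1.
by rewrite -scalerA omega_height1.
Qed.
End HeightOne.

(** * Evaluation of rational numbers by binary arithmetic *)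

(* The scope key Q stands for rat here. *)
Definition Q0 : Q := Qmake Z0 xH.
Definition Q1 : Q := Qmake (Zpos xH) xH.
Definition z2r (z : Z) : rat := (int_of_Z z)%:~R.
Definition q2r (x : Q) : rat := z2r (Qnum x) / z2r (Zpos (Qden x)).

Lemma z2rD x y : z2r (Z.add x y) = z2r x + z2r y.
Proof. by rewrite /z2r -intrD; congr (_%:~R); lia. Qed.

Lemma z2rM x y : z2r (Z.mul x y) = z2r x * z2r y.
Proof. by rewrite /z2r -intrM; congr (_%:~R); lia. Qed.

Lemma z2r_pos p : z2r (Zpos p) != 0.
Proof. by rewrite /z2r intr_eq0; lia. Qed.

Lemma q2rD x y : q2r (Qplus x y) = q2r x + q2r y.
Proof. by rewrite /q2r /= z2rD !z2rM Pos2Z.inj_mul z2rM addf_div ?z2r_pos. Qed.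

Lemma q2rM x y : q2r (Qmult x y) = q2r x * q2r y.
Proof. by rewrite /q2r /= Pos2Z.inj_mul !z2rM mulf_div. Qed.

Lemma q2r_eq x y : Qeq x y -> q2r x = q2r y.
Proof.
by rewrite /Qeq => e; apply/eqP; rewrite /q2r eqr_div ?z2r_pos // -!z2rM e.
Qed.

Lemma q2r_red x : q2r (Qred x) = q2r x.
Proof. by apply: q2r_eq; apply: Qred_correct. Qed.

(** The conventions agree at 0: both inverses send 0 to 0. *)
Lemma q2rV x : q2r (Qinv x) = (q2r x)^-1.
Proof.
rewrite /q2r invf_div; case: x => [[|p|p] d] /=; rewrite ?invr0 ?mulr0 ?mul0r //.
have neg q : z2r (Zneg q) = - z2r (Zpos q).
  by rewrite /z2r -mulrNz; congr (_%:~R); lia.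
by rewrite !neg invrN mulrN mulNr.
Qed.

Lemma q2r_div x y : q2r (Qdiv x y) = q2r x / q2r y.
Proof. by rewrite q2rM q2rV. Qed.

Definition n2q (n : nat) : Q := inject_Z (Z.of_nat n).

Lemma q2r_nat n : q2r (n2q n) = n%:R.
Proof.
by rewrite /q2r /= /z2r divr1 [RHS]pmulrn; congr (_%:~R); lia.
Qed.

Lemma q2r0 : q2r Q0 = 0. Proof. exact: (q2r_nat 0). Qed.
Lemma q2r1 : q2r Q1 = 1. Proof. exact: (q2r_nat 1). Qed.

Lemma q2r_opp x : q2r (Qopp x) = - q2r x.
Proof.
apply/eqP; rewrite -addr_eq0 -q2rD; apply/eqP; rewrite -q2r0; apply: q2r_eq.
by rewrite Qplus_comm Qplus_opp_r.
Qed.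

Lemma q2r_le x y : Qle_bool x y -> q2r x <= q2r y.
Proof.
move/Qle_bool_iff; rewrite /Qle /q2r => h.
have p q : 0 < z2r (Zpos q) by rewrite /z2r ltr0z; lia.
rewrite ler_pdivrMr // mulrAC ler_pdivlMr // -!z2rM /z2r ler_int; lia.
Qed.

(** Reduction after each operation keeps numerators and denominators small during evaluation. *)
Definition sumQ (s : seq Q) : Q := foldr (fun x y => Qred (Qplus x y)) Q0 s.
Definition prodQ (s : seq Q) : Q := foldr (fun x y => Qred (Qmult x y)) Q1 s.

Lemma q2r_sum (I : Type) (r : seq I) (f : I -> Q) :
  q2r (sumQ (map f r)) = \sum_(i <- r) q2r (f i).
Proof.
elim: r => [|i r IHr]; first by rewrite big_nil q2r0.
by rewrite big_cons -IHr -q2rD -[RHS]q2r_red.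
Qed.

Lemma q2r_prod (I : Type) (r : seq I) (f : I -> Q) :
  q2r (prodQ (map f r)) = \prod_(i <- r) q2r (f i).
Proof.
elim: r => [|i r IHr]; first by rewrite big_nil q2r1.
by rewrite big_cons -IHr -q2rM -[RHS]q2r_red.
Qed.

(** * Series truncated modulo q^7 *)

Definition trunc_eq (f : series rat) (s : seq Q) : Prop :=
  forall n, (n < 7)%N -> f n = q2r (nth Q0 s n).

Definition smulQ (s t : seq Q) : seq Q := mkseq (fun n =>
  sumQ [seq Qmult (nth Q0 s i) (nth Q0 t (n - i)) | i <- iota 0 n.+1]) 7.
Definition soneQ : seq Q := mkseq (fun n => n2q (n == 0%N)) 7.
Definition spowQ (s : seq Q) (k : nat) : seq Q := iter k (smulQ s) soneQ.
Definition sm1Q (s : seq Q) : seq Q :=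
  mkseq (fun n => Qplus (nth Q0 s n) (Qopp (nth Q0 soneQ n))) 7.
Definition signQ (k : nat) : Q := if odd k then Qopp Q1 else Q1.
Definition slogQ (s : seq Q) : seq Q := mkseq (fun n =>
  sumQ [seq Qmult (Qdiv (signQ k.+1) (n2q k)) (nth Q0 (spowQ (sm1Q s) k) n) | k <- iota 1 n]) 7.
Definition sexpQ (s : seq Q) : seq Q := mkseq (fun n =>
  sumQ [seq Qmult (Qinv (n2q k`!)) (nth Q0 (spowQ s k) n) | k <- iota 0 n.+1]) 7.
Definition geomQ (m : nat) : seq Q := mkseq (fun n => n2q (m %| n)) 7.
Definition macmahonQ : seq Q := mkseq (fun n =>
  nth Q0 (foldr smulQ soneQ [seq spowQ (geomQ m) m | m <- iota 1 n]) n) 7.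
Definition macmahon_neg_powQ (a : Q) : seq Q :=
  sexpQ (mkseq (fun n => Qmult a (nth Q0
    (slogQ (mkseq (fun m => Qmult (signQ m) (nth Q0 macmahonQ m)) 7)) n)) 7).

Lemma trunc_mkseq (f : series rat) (s : nat -> Q) : (forall n, (n < 7)%N -> f n = q2r (s n)) ->
  trunc_eq f (mkseq s 7).
Proof. by move=> h n n7; rewrite nth_mkseq // h. Qed.

Lemma trunc_smul f g s t : trunc_eq f s -> trunc_eq g t -> trunc_eq (smul f g) (smulQ s t).
Proof.
move=> fs gt; apply: trunc_mkseq => n n7; rewrite q2r_sum /smul.
rewrite -(big_mkord xpredT (fun i => f i * g (n - i)%N)) /index_iota subn0.
apply: eq_big_seq => i; rewrite mem_iota add0n ltnS => /andP[_ le_in].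
by rewrite q2rM fs ?gt //; lia.
Qed.

Lemma trunc_sone : trunc_eq (sone rat) soneQ.
Proof. by apply: trunc_mkseq => n _; rewrite q2r_nat. Qed.

Lemma trunc_spow f s k : trunc_eq f s -> trunc_eq (spow f k) (spowQ s k).
Proof. by move=> h; elim: k => [|k IHk]; [apply: trunc_sone | apply: trunc_smul]. Qed.

Lemma q2r_sign k : q2r (signQ k) = (-1) ^+ k.
Proof. by rewrite -signr_odd /signQ; case: (odd k); rewrite ?q2r_opp q2r1. Qed.

Lemma trunc_slog f s : trunc_eq f s -> trunc_eq (slog f) (slogQ s).
Proof.
move=> h; apply: trunc_mkseq => n n7; rewrite q2r_sum /slog /index_iota subn1 /=.
apply: eq_bigr => k _; rewrite q2rM q2r_div q2r_sign q2r_nat.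
congr (_ * _); apply: (@trunc_spow _ _ k) => //; apply: trunc_mkseq => m m7.
by rewrite q2rD q2r_opp h // (trunc_sone m7).
Qed.

Lemma trunc_sexp f s : trunc_eq f s -> trunc_eq (sexp f) (sexpQ s).
Proof.
move=> h; apply: trunc_mkseq => n n7; rewrite q2r_sum /sexp /index_iota subn0.
by apply: eq_bigr => k _; rewrite q2rM q2rV q2r_nat -(trunc_spow k h).
Qed.

Lemma trunc_macmahon : trunc_eq (macmahon rat) macmahonQ.
Proof.
apply: trunc_mkseq => n n7; rewrite /macmahon /index_iota subn1 /=.
(* The induction on the list of factors needs all seven coefficients, not only the one at [n]. *)
suff h : trunc_eq (\big[@smul rat/sone rat]_(m <- iota 1 n) spow (geom rat m) m)
  (foldr smulQ soneQ [seq spowQ (geomQ m) m | m <- iota 1 n]) by apply: h.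
elim: (iota 1 n) => [|m r IHr]; first by rewrite big_nil; apply: trunc_sone.
rewrite big_cons; apply: trunc_smul => //; apply: trunc_spow.
by apply: trunc_mkseq => k _; rewrite q2r_nat.
Qed.

Lemma trunc_macmahon_neg_pow a : trunc_eq (macmahon_neg_pow (q2r a)) (macmahon_neg_powQ a).
Proof.
apply: trunc_sexp; apply: trunc_mkseq => n n7; rewrite q2rM; congr (_ * _).
apply: trunc_slog n7; apply: trunc_mkseq => m m7.
by rewrite q2rM q2r_sign (trunc_macmahon m7).
Qed.

(** * Powers of the MacMahon series are polynomial in the exponent *)

Section SeriesMorphism.
Variables (F : fieldType) (phi : {rmorphism rat -> F}).

Lemma smul_map f g : smul (phi \o f) (phi \o g) = phi \o smul f g.
Proof.
by apply/funext => n; rewrite /= rmorph_sum; apply: eq_bigr => i _; rewrite rmorphM.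
Qed.

Lemma sone_map : sone F = phi \o sone rat.
Proof. by apply/funext => n; rewrite /= rmorph_nat. Qed.

Lemma spow_map f k : spow (phi \o f) k = phi \o spow f k.
Proof.
by elim: k => [|k IHk]; [apply: sone_map | rewrite /spow !iterS -!/(spow _ _) IHk smul_map].
Qed.

Lemma slog_map f : slog (phi \o f) = phi \o slog f.
Proof.
apply/funext => n; rewrite /= rmorph_sum; apply: eq_bigr => k _ /=.
have -> : (fun m => (phi \o f) m - sone F m) = phi \o (fun m => f m - sone rat m).
  by apply/funext => m; rewrite sone_map /= rmorphB.
by rewrite spow_map /= rmorphM fmorph_div rmorph_sign rmorph_nat.
Qed.

Lemma macmahon_map : macmahon F = phi \o macmahon rat.
Proof.
apply/funext => n; rewrite /= /macmahon.
suff -> : \big[@smul F/sone F]_(1 <= m < n.+1) spow (geom F m) m =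
  phi \o \big[@smul rat/sone rat]_(1 <= m < n.+1) spow (geom rat m) m by [].
elim: (index_iota 1 n.+1) => [|m r IHr]; first by rewrite !big_nil sone_map.
rewrite !big_cons IHr -smul_map -spow_map; congr (smul (spow _ _) _).
by apply/funext => k; rewrite /= rmorph_nat.
Qed.

(** The coefficient of $a^k$ in the coefficient of $q^n$ of $M(-q)^a$, by [macmahon_neg_powE]. Being
    rational, it is preserved when $a$ is evaluated or restricted. *)
Definition mm_coef (n k : nat) : rat :=
  (k`!%:R)^-1 * spow (slog (fun m => (-1) ^+ m * macmahon rat m)) k n.

Lemma spow_scale (a : F) f k : spow (fun n => a * f n) k = fun n => a ^+ k * spow f k n.
Proof.
elim: k => [|k IHk]; first by apply/funext => n; rewrite mul1r.
apply/funext => n; rewrite /spow !iterS -!/(spow _ _) IHk /smul mulr_sumr.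
by apply: eq_bigr => i _; rewrite exprS; ring.
Qed.

Lemma macmahon_neg_powE (a : F) n :
  macmahon_neg_pow a n = \sum_(0 <= k < n.+1) a ^+ k * phi (mm_coef n k).
Proof.
rewrite /macmahon_neg_pow /sexp; apply: eq_bigr => k _.
have -> : slog (fun m => (-1) ^+ m * macmahon F m) =
    phi \o slog (fun m => (-1) ^+ m * macmahon rat m).
  rewrite -slog_map; congr slog; apply/funext => m.
  by rewrite macmahon_map /= rmorphM rmorph_sign.
by rewrite spow_scale spow_map /mm_coef rmorphM fmorphV rmorph_nat /=; ring.
Qed.
End SeriesMorphism.

(** * Enumeration of small solid partitions *)

(* A solid partition is encoded by the multiset of its positions. *)
Definition pos := (nat * nat * nat)%type.

Definition succs (b : pos) : seq pos :=
  let: (i, j, k) := b in [:: (i.+1, j, k); (i, j.+1, k); (i, j, k.+1)].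

Definition addable (s : seq pos) (b : pos) : bool :=
  let: (i, j, k) := b in let m := count_mem b s in
  [&& if i is i'.+1 then (m < count_mem (i', j, k) s)%N else true,
      if j is j'.+1 then (m < count_mem (i, j', k) s)%N else true
    & if k is k'.+1 then (m < count_mem (i, j, k') s)%N else true].

Definition lexle (b c : pos) : bool :=
  let: (i, j, k) := b in let: (i', j', k') := c in
  (i < i')%N || (i == i') && ((j < j')%N || (j == j') && (k <= k')%N).

(** A box is added over the origin or over a successor of an occupied position. Sorting makes the
    code of a multiset canonical, so that [undup] merges different orders of growth. *)
Fixpoint codes (n : nat) : seq (seq pos) :=
  if n is m.+1 then
    undup [seq sort lexle (b :: s) | s <- codes m,
             b <- filter (addable s) ((0, 0, 0)%N :: flatten (map succs s))]
  else [:: [::]].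

Definition encodes (s : seq pos) (pi : array3) : Prop := forall b, pi b = count_mem b s.

Lemma psize_sup (pi : array3) (D : {fset nat * nat * nat}) :
  (finsupp pi `<=` D)%fset -> psize pi = (\sum_(b <- D) pi b)%N.
Proof.
move=> sD; rewrite /psize; apply: big_fset_incl => // b _ nb.
by rewrite fsfun_dflt.
Qed.

Lemma le_psize (pi : array3) b : (pi b <= psize pi)%N.
Proof.
have [bin|nin] := boolP (b \in finsupp pi); last by rewrite fsfun_dflt.
by rewrite /psize (bigD1_seq b) ?fset_uniq //= leq_addr.
Qed.

(** A position of the support with maximal $i+j+k$ works, since its three successors have a larger
    sum. *)
Lemma solid_corner (pi : array3) : solid pi -> (0 < psize pi)%N ->
  exists i j k, [/\ (0 < pi (i, j, k))%N, pi (i.+1, j, k) = 0%N,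
     pi (i, j.+1, k) = 0%N & pi (i, j, k.+1) = 0%N].
Proof.
move=> s p0; have [b0 b0in] : exists b, b \in finsupp pi.
  case: (fset_0Vmem (finsupp pi)) => [e|[b bin]]; last by exists b.
  by rewrite /psize e big_seq_fset0 in p0.
pose f (x : finsupp pi) := ((val x).1.1 + (val x).1.2 + (val x).2)%N.
case: (@arg_maxnP _ (FSetSub b0in) xpredT f isT) => -[[[i j] k] /= bin] _ hmax.
exists i, j, k.
have out c : (i + j + k < c.1.1 + c.1.2 + c.2)%N -> pi c = 0%N.
  move=> lt; apply: fsfun_dflt; apply/negP => cin.
  by have := hmax (FSetSub cin) isT; rewrite /f /= leqNgt lt.
split; try by (rewrite out //=; lia).
by rewrite lt0n; move: (bin); rewrite mem_finsupp.
Qed.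

(** Induction on the size: the top box over a position from [solid_corner] is removed, which keeps
    the array solid because the successors of that position are 0. *)
Lemma codes_complete n (pi : array3) : solid pi -> psize pi = n ->
  exists2 s, s \in codes n & encodes s pi.
Proof.
elim: n pi => [|n IHn] pi s en.
  exists [::]; rewrite ?inE // => b; have := le_psize pi b; rewrite en leqn0.
  by move/eqP->.
have [|i [j [k [p0 pi1 pj1 pk1]]]] := solid_corner s; first by rewrite en.
pose b : pos := (i, j, k).
pose pi' : array3 := [fsfun pi with b |-> (pi b).-1].
have e' c : pi' c = if c == b then (pi b).-1 else pi c.
  by rewrite /pi' fsfun_withE.
have s' : solid pi'.
  move=> i0 j0 k0; have [h1 h2 h3] := s i0 j0 k0; rewrite !e'.
  have le c : ((if c == b then (pi b).-1 else pi c) <= pi c)%N.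
    by case: eqP => [->|//]; exact: leq_pred.
  case: (eqVneq (i0, j0, k0) b) => [e|_]; last first.
    split; [exact: leq_trans (le _) h1 | exact: leq_trans (le _) h2
      | exact: leq_trans (le _) h3].
  case: e => -> -> ->.
  split; [apply: leq_trans (le _) _; rewrite pi1 | apply: leq_trans (le _) _; rewrite pj1
    | apply: leq_trans (le _) _; rewrite pk1] => //.
have n' : psize pi' = n.
  have sub : (finsupp pi' `<=` finsupp pi)%fset.
    apply/fsubsetP => c; rewrite !mem_finsupp e'; case: (eqVneq c b) => // -> _.
    by rewrite -lt0n.
  have bin : b \in finsupp pi by rewrite mem_finsupp -lt0n.
  rewrite (psize_sup sub) (bigD1_seq b) ?fset_uniq //= e' eqxx.
  move: en; rewrite /psize (bigD1_seq b) ?fset_uniq //=.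
  under [X in _ -> (_ + X)%N = _]eq_bigr => c /negPf cb do rewrite e' cb.
  by move: p0; rewrite -/b; case: (pi b) => // m _ [].
have [t tin enc] := IHn pi' s' n'.
have bs : b \in (0, 0, 0)%N :: flatten (map succs t).
  have mem_t c : (0 < pi c)%N -> c != b -> c \in t.
    by move=> c0 /negPf cb; rewrite -has_pred1 has_count -enc e' cb.
  rewrite inE; apply/orP; case: (posnP (i + j + k)) => [e|ijk]; [left|right].
    by rewrite /b; apply/eqP; congr (_, _, _); lia.
  apply/flattenP.
  have pred c : (pi b <= pi c)%N -> c != b -> b \in succs c ->
      exists2 r, r \in map succs t & b \in r.
    move=> le cb bc; exists (succs c) => //; apply: map_f; apply: mem_t => //.
    exact: leq_trans p0 le.
  have [i0|i0] := posnP i; last first.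
    apply: (pred (i.-1, j, k)); first exact: solid_mono (leq_pred i) _ _.
      by rewrite !xpair_eqE !eqxx !andbT; lia.
    by rewrite !inE /= prednK // eqxx.
  have [j0|j0] := posnP j; last first.
    apply: (pred (i, j.-1, k)); first exact: solid_mono _ (leq_pred j) _.
      by rewrite !xpair_eqE !eqxx ?andbT; lia.
    by rewrite !inE /= prednK // eqxx !orbT.
  have [k0|k0] := posnP k; first by lia.
  apply: (pred (i, j, k.-1)); first exact: solid_mono _ _ (leq_pred k).
    by rewrite !xpair_eqE !eqxx ?andbT; lia.
  by rewrite !inE /= prednK // eqxx !orbT.
have add : addable t b.
  have lt c : (pi b <= pi c)%N -> c != b -> (count_mem b t < count_mem c t)%N.
    by move=> le /negPf cb; rewrite -!enc !e' eqxx cb prednK.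
  rewrite /addable /b; apply/and3P; split.
  - case ei: i => [|i'] //; move: (lt (i', j, k)); rewrite /b ei; apply.
      exact: solid_mono (leqnSn i') _ _.
    by rewrite !xpair_eqE !eqxx !andbT; lia.
  - case ej: j => [|j'] //; move: (lt (i, j', k)); rewrite /b ej; apply.
      exact: solid_mono _ (leqnSn j') _.
    by rewrite !xpair_eqE !eqxx ?andbT; lia.
  case ek: k => [|k'] //; move: (lt (i, j, k')); rewrite /b ek; apply.
    exact: solid_mono _ _ (leqnSn k').
  by rewrite !xpair_eqE !eqxx ?andbT; lia.
exists (sort lexle (b :: t)).
  rewrite mem_undup; apply/allpairsPdep; exists t, b; split=> //.
  by rewrite mem_filter add bs.
move=> c; rewrite (permP (permEl (perm_sort lexle (b :: t)))) /= -enc e' eq_sym.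
by case: eqP => // ->; rewrite add1n prednK.
Qed.

Definition decode (s : seq pos) : array3 :=
  [fsfun b in seq_fset tt s => count_mem b s | 0%N].

Lemma decodeE s : encodes s (decode s).
Proof.
move=> b; rewrite /decode fsfunE seq_fsetE; case: ifP => // /negbT.
by rewrite -has_pred1 has_count -leqNgt leqn0 => /eqP ->.
Qed.

Lemma encodes_decode s pi : encodes s pi -> pi = decode s.
Proof. by move=> h; apply/fsfunP => b; rewrite decodeE h. Qed.

(** * Computation of omega *)

Definition zvec := (Z * Z * Z * Z)%type.

Definition wt (x : zvec) : weight :=
  let: (x0, x1, x2, x3) := x in \row_(i < 4) int_of_Z (nth Z0 [:: x0; x1; x2; x3] i).
Arguments wt : simpl never.

Definition boxQ (s : seq pos) : seq zvec :=
  [seq (Z.of_nat b.1.1, Z.of_nat b.1.2, Z.of_nat b.2, Z.of_nat l)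
     | b <- undup s, l <- iota 0 (count_mem b s)].

Lemma wtE x0 x1 x2 x3 (w : weight) : (wt (x0, x1, x2, x3) == w) =
  [&& int_of_Z x0 == w 0 (inord 0), int_of_Z x1 == w 0 (inord 1),
      int_of_Z x2 == w 0 (inord 2) & int_of_Z x3 == w 0 (inord 3)].
Proof.
apply/eqP/and4P => [<-|[/eqP e0 /eqP e1 /eqP e2 /eqP e3]].
  by rewrite /wt !mxE !inordK.
by apply: weightP; rewrite /wt mxE inordK.
Qed.

Lemma wt_box b l :
  wt (Z.of_nat b.1.1, Z.of_nat b.1.2, Z.of_nat b.2, Z.of_nat l) = bweight b l.
Proof.
case: b => [[i j] k] /=; apply/eqP.
rewrite wtE !mxE !(tnth_nth 0%N) /= !inordK //=.
by apply/and4P; split; apply/eqP; lia.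
Qed.

Lemma char_decode s : char (boxes (decode s)) = char (map wt (boxQ s)).
Proof.
rewrite /char big_boxes big_map big_allpairs_dep /=.
rewrite (perm_big (undup s)) => [|]; last first.
  apply: uniq_perm; rewrite ?fset_uniq ?undup_uniq // => b.
  by rewrite mem_undup mem_finsupp decodeE -lt0n -has_count has_pred1.
apply: eq_bigr => b _; rewrite decodeE.
rewrite -(big_mkord xpredT (fun l => mono (bweight b l))) /index_iota subn0.
by apply: eq_bigr => l _; rewrite wt_box.
Qed.

Section DifferenceQuotient.
Variables (F : fieldType).

(** Multiplying a character by $1-t^u$ amounts to replacing [h] by this quotient. The cubic factor
    of the half vertex is thereby absorbed into the function, and the product runs over pairs of
    boxes only. *)
Definition dquot (u : weight) (h : weight -> F) (w : weight) : F :=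
  unz (h w) / unz (h (w + u)).

Lemma wprod_dquot h u f : wprod h (f * (1 - mono u)) = wprod (dquot u h) f.
Proof.
rewrite mulrBr mulr1 wprodB wprod_mulmono.
apply: (mulIf (wprod_neq0 (fun w => h (w + u)) f)); rewrite divfK ?wprod_neq0 //.
apply: wprod_split => w.
by rewrite [unz (dquot _ _ _)]unz_id ?divfK ?mulf_neq0 ?invr_neq0 ?unz_neq0.
Qed.
End DifferenceQuotient.

Definition addZ (x y : zvec) : zvec :=
  let: (x0, x1, x2, x3) := x in let: (y0, y1, y2, y3) := y in
  (Z.add x0 y0, Z.add x1 y1, Z.add x2 y2, Z.add x3 y3).
Definition subZ (x y : zvec) : zvec :=
  let: (x0, x1, x2, x3) := x in let: (y0, y1, y2, y3) := y in
  (Z.sub x0 y0, Z.sub x1 y1, Z.sub x2 y2, Z.sub x3 y3).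

Lemma wt_add x y : wt (addZ x y) = wt x + wt y.
Proof.
case: x y => [[[x0 x1] x2] x3] [[[y0 y1] y2] y3]; apply/eqP.
rewrite wtE /wt !mxE !inordK //=; apply/and4P; split; apply/eqP; lia.
Qed.

Lemma wt_sub x y : wt (subZ x y) = wt x - wt y.
Proof.
case: x y => [[[x0 x1] x2] x3] [[[y0 y1] y2] y3]; apply/eqP.
rewrite wtE /wt !mxE !inordK //=; apply/and4P; split; apply/eqP; lia.
Qed.

(** The value computed is that of [unz (h _)], which is never 0, so quotients of computed values are
    meaningful. *)
Definition computes (h : weight -> rat) (hQ : zvec -> Q) : Prop :=
  forall x, unz (h (wt x)) = q2r (hQ x).

Definition dquotQ (u : zvec) (hQ : zvec -> Q) (x : zvec) : Q :=
  Qdiv (hQ x) (hQ (addZ x u)).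

Lemma computes_dquot h hQ u : computes h hQ -> computes (dquot (wt u) h) (dquotQ u hQ).
Proof.
move=> c x; rewrite q2r_div -!c wt_add unz_id //.
by rewrite mulf_neq0 ?invr_neq0 ?unz_neq0.
Qed.

Definition nfacQ (x : zvec) : Q :=
  let: (x0, x1, x2, x3) := x in
  if Z.eqb x0 x1 && Z.eqb x1 x2 && ~~ Z.eqb x3 x0 then inject_Z (Z.abs (Z.sub x3 x0)) else Q1.

Lemma computes_nfac : computes nfac nfacQ.
Proof.
case=> [[[x0 x1] x2] x3]; rewrite /nfac /diag /height /wt !mxE !inordK //= /nfacQ.
have eqz (x y : Z) : (int_of_Z x == int_of_Z y) = Z.eqb x y by lia.
rewrite !eqz; case: (_ && _) => /=; last by rewrite unz1 q2r1.
case: (boolP (Z.eqb x3 x0)) => /= e.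
  by rewrite q2r1 /unz intr_eq0; have -> : (`|int_of_Z x3 - int_of_Z x0| == 0) by lia.
rewrite unz_id ?intr_eq0; last by lia.
by rewrite /q2r /= /z2r divr1; congr (_%:~R); lia.
Qed.

Definition d3Q : zvec -> Q :=
  dquotQ (Zneg 1, Z0, Z0, Z0) (dquotQ (Z0, Zneg 1, Z0, Z0) (dquotQ (Z0, Z0, Zneg 1, Z0) nfacQ)).

(** The exponent $-v$ is the quadratic term minus $Z$: pairs of boxes go to the numerator, single
    boxes to the denominator. *)
Definition omegaQ (B : seq zvec) : Q :=
  Qdiv (prodQ [seq prodQ [seq d3Q (subZ x y) | y <- B] | x <- B]) (prodQ (map nfacQ B)).

Lemma omega_wt B : omega (map wt B) = q2r (omegaQ B).
Proof.
rewrite /omega /vhalf wprodN wprodB invf_div q2r_div !q2r_prod; congr (_ / _); last first.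
  by rewrite /char big_map wprod_sum; apply: eq_bigr => x _; rewrite wprod_mono computes_nfac.
have -> : lbar (cube 3) = (1 - tinv1 0) * (1 - tinv1 1) * (1 - tinv1 2).
  by rewrite cube3 !(lbarM, lbarB, lbar1) -!/(tvar _) !lbar_tvar.
have tE i x : (i < 4)%N -> wt x = - delta_mx 0 (inord i) -> tinv1 i = mono (wt x).
  by move=> _ ->.
rewrite (@tE 0%N (Zneg 1, Z0, Z0, Z0)) //; last first.
  by apply/eqP; rewrite wtE !mxE -!val_eqE /= !inordK.
rewrite (@tE 1%N (Z0, Zneg 1, Z0, Z0)) //; last first.
  by apply/eqP; rewrite wtE !mxE -!val_eqE /= !inordK.
rewrite (@tE 2%N (Z0, Z0, Zneg 1, Z0)) //; last first.
  by apply/eqP; rewrite wtE !mxE -!val_eqE /= !inordK.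
rewrite !mulrA !wprod_dquot.
set h := dquot _ _.
have hQ : computes h d3Q by do !apply: computes_dquot; apply: computes_nfac.
have -> : char (map wt B) * lbar (char (map wt B)) =
    \sum_(x <- B) \sum_(y <- B) mono (wt (subZ x y)).
  rewrite lbar_char /char !big_map mulr_suml; apply: eq_bigr => x _.
  by rewrite mulr_sumr; apply: eq_bigr => y _; rewrite -monoD wt_sub.
rewrite wprod_sum; apply: eq_bigr => x _; rewrite wprod_sum q2r_prod.
by apply: eq_bigr => y _; rewrite wprod_mono hQ.
Qed.

(* The specialization of L(0,0,0,-6) w, up to sign, when pi(2,2,2) = 0. *)
Definition value6 (pi : array3) : rat :=
  omega (boxes pi) * \prod_(l < pi (0, 0, 0)%N) (6 - l%:R).

Definition value6Q (s : seq pos) : Q :=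
  Qmult (omegaQ (boxQ s))
    (prodQ [seq Qplus (n2q 6) (Qopp (n2q l)) | l <- iota 0 (count_mem (0, 0, 0)%N s)]).

Lemma value6_decode s : value6 (decode s) = q2r (value6Q s).
Proof.
rewrite /value6 /value6Q q2rM q2r_prod decodeE; congr (_ * _).
  by rewrite -omega_wt /omega char_decode.
rewrite -(big_mkord xpredT (fun l => 6 - l%:R)) /index_iota subn0.
by apply: eq_bigr => l _; rewrite q2rD q2r_opp !q2r_nat.
Qed.

(** The value $d=6$ makes every factor $d-(l-1)$ positive for columns of height at most 6. An upper
    bound for the sum of values is enough, since the signed sum is known and all values are
    positive. *)
Lemma codes_check : all (fun n =>
    all (fun s => (count_mem (1, 1, 1)%N s == 0) && (count_mem (0, 0, 0)%N s <= 6))%N (codes n) &&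
    Qle_bool (sumQ (map value6Q (codes n)))
      (Qmult (signQ n) (nth Q0 (macmahon_neg_powQ (n2q 6)) n)))
  (iota 0 7).
Proof. by vm_cast_no_check (erefl true). Qed.

(** * Evaluation and restriction of the generating series *)

Lemma eq_Lprod (R : comNzRingType) (la la' d d' : 'I_4 -> R) pi :
  la =1 la' -> d =1 d' -> Lprod la d pi = Lprod la' d' pi.
Proof.
move=> ela ed; apply: eq_bigr => b _; apply: eq_bigr => l _; apply: eq_bigr => i _.
by rewrite ela ed.
Qed.

Lemma Lprod_rmorph (R S : comNzRingType) (f : {rmorphism R -> S}) la d pi :
  f (Lprod la d pi) = Lprod (f \o la) (f \o d) pi.
Proof.
rewrite rmorph_prod; apply: eq_bigr => b _; rewrite rmorph_prod; apply: eq_bigr => l _.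
rewrite rmorph_sum; apply: eq_bigr => i _.
by rewrite rmorphM rmorphD rmorph_nat.
Qed.

Definition constKD (F : fieldType) : F -> {fraction {mpoly F[4]}} :=
  @tofrac _ \o @mpolyC 4 F.
HB.instance Definition _ (F : fieldType) := GRing.RMorphism.on (@constKD F).

(** Both sides are polynomials in the $d_i$, the right one because $M(-q)^a$ is polynomial in $a$
    coefficientwise. As [tofrac] is injective, the identity holds between polynomials and can be
    evaluated. *)
Lemma generating_eval (F : fieldType) (phi : {rmorphism rat -> F}) (la d : 'I_4 -> F)
    (c : F) (r : seq array3) (w : array3 -> F) n :
  \sum_(pi <- r) Lprod (fun i => constKD (la i)) (fun i => ('X_i)%:F) pi * constKD (w pi)
    = macmahon_neg_pow ((\sum_(i < 4) ('X_i)%:F * constKD (la i)) * constKD c) n ->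
  \sum_(pi <- r) Lprod la d pi * w pi = macmahon_neg_pow ((\sum_(i < 4) d i * la i) * c) n.
Proof.
rewrite (macmahon_neg_powE (@constKD F \o phi)) (macmahon_neg_powE phi).
pose P1 : {mpoly F[4]} := \sum_(pi <- r)
  Lprod (fun i => (la i)%:MP_[4]) (fun i => 'X_i) pi * (w pi)%:MP_[4].
pose P2 : {mpoly F[4]} := \sum_(0 <= k < n.+1)
  ((\sum_(i < 4) 'X_i * (la i)%:MP_[4]) * c%:MP_[4]) ^+ k * (phi (mm_coef n k))%:MP_[4].
have e1 : P1%:F = \sum_(pi <- r)
    Lprod (fun i => constKD (la i)) (fun i => ('X_i)%:F) pi * constKD (w pi).
  rewrite rmorph_sum; apply: eq_bigr => pi _; rewrite rmorphM; congr (_ * _).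
  exact: (Lprod_rmorph (@tofrac {mpoly F[4]})).
have e2 : P2%:F = \sum_(0 <= k < n.+1)
    ((\sum_(i < 4) ('X_i)%:F * constKD (la i)) * constKD c) ^+ k
    * (@constKD F \o phi) (mm_coef n k).
  rewrite rmorph_sum; apply: eq_bigr => k _; rewrite rmorphM rmorphXn rmorphM.
  congr ((_ * _) ^+ _ * _); rewrite rmorph_sum; apply: eq_bigr => i _.
  by rewrite rmorphM.
rewrite -e1 -e2 => /eqP; rewrite tofrac_eq => /eqP /(congr1 (meval d)).
rewrite /P1 /P2 !rmorph_sum /= => h.
under eq_bigr => pi _.
  have -> : Lprod la d pi * w pi = (Lprod (fun i => (la i)%:MP_[4]) (fun i => 'X_i) pi
      * (w pi)%:MP_[4]).@[d].
    rewrite rmorphM /= mevalC (Lprod_rmorph (meval d)); congr (_ * _).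
    by apply: eq_Lprod => i /=; rewrite ?mevalC ?mevalXU.
  over.
rewrite h; apply: eq_bigr => k _.
rewrite rmorphM /= rmorphXn /= rmorphM /= !mevalC; congr ((_ * _) ^+ _ * _).
by rewrite rmorph_sum; apply: eq_bigr => i _; rewrite rmorphM /= mevalC mevalXU.
Qed.

Definition mm_factor (F : fieldType) (l0 l1 l2 l3 : F) : F :=
  (- l0 * l1 * l2 - l0 * l1 * l3 - l0 * l2 * l3 - l1 * l2 * l3) / (l0 * l1 * l2 * l3).

Lemma mm_factor_rmorph (F F' : fieldType) (f : {rmorphism F -> F'}) l0 l1 l2 l3 :
  f (mm_factor l0 l1 l2 l3) = mm_factor (f l0) (f l1) (f l2) (f l3).
Proof. by rewrite /mm_factor fmorph_div !(rmorphB, rmorphM, rmorphN). Qed.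

Definition exponentKD (F : fieldType) (la : 'I_4 -> F) : {fraction {mpoly F[4]}} :=
  let l i := constKD (la (inord i)) in
  (\sum_(i < 4) ('X_i)%:F * constKD (la i))
  * (- l 0%N * l 1%N * l 2%N - l 0%N * l 1%N * l 3%N
     - l 0%N * l 2%N * l 3%N - l 1%N * l 2%N * l 3%N)
  / (l 0%N * l 1%N * l 2%N * l 3%N).

Lemma exponentKDE (F : fieldType) (la : 'I_4 -> F) : exponentKD la =
  (\sum_(i < 4) ('X_i)%:F * constKD (la i)) *
  constKD (mm_factor (la (inord 0)) (la (inord 1)) (la (inord 2)) (la (inord 3))).
Proof. by rewrite mm_factor_rmorph /mm_factor mulrA. Qed.

(* True by conversion, but K carries two unfoldings of its ring structure, which
   only the kernel compares fast. *)
Lemma mm_exponentE : mm_exponent = exponentKD lam.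
Proof. exact_no_check (erefl mm_exponent). Qed.

Definition mmK : K :=
  mm_factor (lam (inord 0)) (lam (inord 1)) (lam (inord 2)) (lam (inord 3)).

Lemma lam012_neq0 i : (i < 3)%N -> lam0 (inord i) != 0.
Proof.
move=> i3; apply/eqP => e.
pose u : weight := \row_(j < 4) (j == inord i)%:R.
have /lw0_eq0 : lw0 u = 0.
  rewrite /lw0 (bigD1 (inord i)) //= !mxE eqxx mulr1z e add0r big1 // => j /negPf ne.
  by rewrite mxE ne.
by rewrite /diag !mxE -!val_eqE /= !inordK; case: i i3 {e u} => [|[|[|]]].
Qed.

Lemma mul_mm_factor (F : fieldType) (r l0 l1 l2 l3 : F) :
  l0 != 0 -> l1 != 0 -> l2 != 0 -> l3 != 0 ->
  - r * l3 * mm_factor l0 l1 l2 l3 =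
  r * (l0 * l1 * l2 + l3 * (l0 * l1 + l0 * l2 + l1 * l2)) / (l0 * l1 * l2).
Proof. by move=> *; rewrite /mm_factor; field; apply/and4P. Qed.

Lemma spec_neq0 f g : specializes f g -> g != 0 -> f != 0.
Proof. by move=> s; apply: contraNneq => f0; apply/eqP/(spec_uniq s); rewrite f0; apply: spec0. Qed.

(** At $d=(0,0,0,-r)$ the numerator of the exponent acquires the factor $-r\lambda_4$, which cancels
    the pole; at $\lambda_4=0$ only $r\lambda_1\lambda_2\lambda_3/(\lambda_1\lambda_2\lambda_3)$ is
    left. *)
Lemma spec_mm_exponent r :
  specializes (- ratr r * lam (inord 3) * mmK) (ratr r).
Proof.
have s0 := spec_lam (inord 0); have s1 := spec_lam (inord 1).
have s2 := spec_lam (inord 2); have s3 := spec_lam (inord 3).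
have n0 := lam012_neq0 (isT : (0 < 3)%N); have n1 := lam012_neq0 (isT : (1 < 3)%N).
have n2 := lam012_neq0 (isT : (2 < 3)%N).
rewrite /mmK (mul_mm_factor _ (spec_neq0 s0 n0) (spec_neq0 s1 n1) (spec_neq0 s2 n2) lam3_neq0).
have n012 := mulf_neq0 (mulf_neq0 n0 n1) n2.
have -> : ratr r = ratr r * (lam0 (inord 0) * lam0 (inord 1) * lam0 (inord 2)
    + lam0 (inord 3) * (lam0 (inord 0) * lam0 (inord 1) + lam0 (inord 0) * lam0 (inord 2)
       + lam0 (inord 1) * lam0 (inord 2)))
    / (lam0 (inord 0) * lam0 (inord 1) * lam0 (inord 2)) :> K0.
  by case: lam0E => _ _ _ ->; rewrite mul0r addr0 mulfK.
apply: specM; last by apply: specV n012; apply: specM => //; apply: specM.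
apply: specM; first exact: spec_rat.
apply: specD; first by apply: specM => //; apply: specM.
apply: specM => //; apply: specD; last exact: specM.
by apply: specD; apply: specM.
Qed.

Lemma spec_macmahon a b n : specializes a b ->
  specializes (macmahon_neg_pow a n) (macmahon_neg_pow b n).
Proof.
move=> s; rewrite (macmahon_neg_powE (@ratK 3)) (macmahon_neg_powE (@ratK 2)).
apply: spec_sum => k; apply: specM; first exact: specX.
by rewrite /= -!ratrE; apply: spec_rat.
Qed.

Lemma macmahon_ratr n r :
  macmahon_neg_pow (ratr r) n = ratr (macmahon_neg_pow r n) :> K0.
Proof.
rewrite !ratrE (macmahon_neg_powE (@ratK 2)) (macmahon_neg_powE idfun) rmorph_sum.
by apply: eq_bigr => k _; rewrite [RHS]rmorphM /= rmorphXn.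
Qed.

Lemma spec_sum_seq (I : eqType) (r : seq I) f g :
  (forall i, i \in r -> specializes (f i) (g i)) ->
  specializes (\sum_(i <- r) f i) (\sum_(i <- r) g i).
Proof.
elim: r => [|i r IHr] h; first by rewrite !big_nil; apply: spec0.
rewrite !big_cons; apply: specD; first by apply: h; rewrite mem_head.
by apply: IHr => j jr; apply: h; rewrite inE jr orbT.
Qed.

(** * Determination of the signs *)

Definition solids (n : nat) : seq array3 :=
  undup [seq pi <- map decode (codes n) | `[< solid pi /\ psize pi = n >] ].

(** Completeness comes from [codes_complete], soundness from the filter in [solids]. *)
Lemma mem_solids n pi : pi \in solids n <-> solid pi /\ psize pi = n.
Proof.
rewrite mem_undup mem_filter; split=> [/andP[/asboolP] //|h].
rewrite asboolT //=; case: h => s e; have [t tin /encodes_decode ->] := codes_complete s e.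
exact: map_f.
Qed.

Lemma codes_checkP n : (n < 7)%N ->
  (forall s, s \in codes n ->
     count_mem (1, 1, 1)%N s = 0%N /\ (count_mem (0, 0, 0)%N s <= 6)%N) /\
  \sum_(s <- codes n) q2r (value6Q s) <= (-1) ^+ n * macmahon_neg_pow 6 n.
Proof.
move=> n7; have /allP/(_ n) := codes_check.
rewrite mem_iota add0n => /(_ n7) /andP[/allP c1 /q2r_le c2]; split=> [s /c1 /andP[/eqP] //|].
rewrite q2r_sum q2rM q2r_sign in c2.
have e6 : (6 : rat) = q2r (n2q 6) by rewrite q2r_nat.
by rewrite e6 (trunc_macmahon_neg_pow _ n7).
Qed.

Lemma solids_corner n pi : (n < 7)%N -> pi \in solids n -> pi (1, 1, 1)%N = 0%N.
Proof.
move=> /codes_checkP[c _]; rewrite mem_undup mem_filter => /andP[_ /mapP[s sin ->]].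
by rewrite decodeE; case: (c s sin).
Qed.

Lemma value6_gt0 (pi : array3) : (pi (0, 0, 0)%N <= 6)%N -> 0 < value6 pi.
Proof.
move=> le6; rewrite /value6 mulr_gt0 ?omega_gt0 // prodr_gt0 // => l _.
by rewrite subr_gt0 ltr_nat (leq_trans (ltn_ord l)).
Qed.

Lemma solids_value6_gt0 n pi : (n < 7)%N -> pi \in solids n -> 0 < value6 pi.
Proof.
move=> n7 /mem_solids[_ e]; apply: value6_gt0; apply: leq_trans (le_psize _ _) _.
by rewrite e.
Qed.

Lemma sum_undup_le (T : eqType) (r : seq T) (f : T -> rat) :
  (forall x, x \in r -> 0 <= f x) -> \sum_(x <- undup r) f x <= \sum_(x <- r) f x.
Proof.
elim: r => [|x r IHr] h; first by [].
have IH : \sum_(y <- undup r) f y <= \sum_(y <- r) f y.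
  by apply: IHr => y yr; apply: h; rewrite inE yr orbT.
rewrite /= big_cons; case: ifP => _; last by rewrite big_cons lerD2l.
by apply: le_trans IH _; rewrite lerDr h ?mem_head.
Qed.

(** Discarding codes and repetitions only decreases a sum of positive terms, so the computed bound
    passes to the solid partitions. *)
Lemma sum_value6 n : (n < 7)%N ->
  \sum_(pi <- solids n) value6 pi <= (-1) ^+ n * macmahon_neg_pow 6 n.
Proof.
move=> n7; have [c0 c] := codes_checkP n7; apply: le_trans c.
have pos s : s \in codes n -> 0 < value6 (decode s).
  by move=> sin; apply: value6_gt0; rewrite decodeE; case: (c0 s sin).
have step : \sum_(pi <- solids n) value6 pi <=
    \sum_(pi <- [seq pi <- map decode (codes n) | `[< solid pi /\ psize pi = n >] ]) value6 pi.
  apply: sum_undup_le => pi; rewrite mem_filter => /andP[_ /mapP[s sin ->]].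
  exact: ltW (pos s sin).
apply: le_trans step _; rewrite big_filter big_map big_mkcond /=.
rewrite !big_seq; apply: ler_sum => s sin; rewrite -value6_decode.
by case: ifP => // _; apply: ltW (pos s sin).
Qed.

Lemma map_polyC_ratr n (c : rat) :
  map_poly ratr c%:P = (ratr c)%:P :> {poly {fraction {mpoly rat[n]}}}.
Proof. by rewrite (eq_map_poly (@ratrE n)) map_polyC /= ratrE. Qed.

Section Signs.
Variables (w : array3 -> K).
Hypothesis hw : forall pi : array3, solid pi -> (psize pi <= 6)%N -> is_w pi (w pi).
Hypothesis hs : sign_identity w.
Variable e : array3 -> bool.
Hypothesis he : forall pi, solid pi -> (psize pi <= 6)%N -> forall d : {poly rat},
  poly_specializes (Lw d pi (w pi))
    (map_poly ratr (((-1) ^+ e pi * omega (boxes pi)) *: diag_prod d (boxes pi))).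

Definition at_minus6 (i : 'I_4) : K := if i == ord_max then - ratr 6 else 0.

Lemma spec_term n pi : (n < 7)%N -> pi \in solids n ->
  specializes (Lprod lam at_minus6 pi * w pi) (ratr ((-1) ^+ e pi * value6 pi)).
Proof.
move=> n7 pin; have [s en] := (mem_solids n pi).1 pin.
(* For a constant $d$ all the information is in the coefficient of degree 0. *)
have := he s _ 6%:P; rewrite en -ltnS => /(_ n7) /(_ 0%N).
have -> : Lw 6%:P pi (w pi) = (Lprod lam at_minus6 pi * w pi)%:P.
  rewrite /Lw polyCM (Lprod_rmorph (@polyC K)); congr (_ * _); apply: eq_Lprod => // i.
  rewrite /at_minus6 /=; case: ifP => _; last by rewrite polyC0.
  by rewrite polyCN map_polyC_ratr.
rewrite diag_prod_corner ?(solids_corner n7 pin) //.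
have -> : \prod_(l < pi (0, 0, 0)%N) (6%:P - l%:R) =
    (\prod_(l < pi (0, 0, 0)%N) (6 - l%:R : rat))%:P :> {poly rat}.
  rewrite [RHS]rmorph_prod; apply: eq_bigr => l _; rewrite /= polyCB; congr (_ - _).
  by rewrite (rmorph_nat (@polyC rat)).
by rewrite -mul_polyC -polyCM map_polyC_ratr !coefC eqxx /value6 mulrA.
Qed.

(** The generating identity is evaluated at $d=(0,0,0,-6)$ and restricted to the hyperplane;
    uniqueness of specializations turns it into an identity of rational numbers. *)
Lemma signed_sum n : (n < 7)%N ->
  \sum_(pi <- solids n) (-1) ^+ e pi * value6 pi = macmahon_neg_pow 6 n.
Proof.
move=> n7; have := hs n7.
have -> : [set pi | solid pi /\ psize pi = n]%classic = [set` solids n]%classic.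
  by apply/seteqP; split => pi /= /mem_solids.
rewrite -fsbig_seq ?undup_uniq // mm_exponentE exponentKDE.
move/(@generating_eval K (@ratK 3) lam at_minus6); rewrite -/mmK.
have -> : \sum_(i < 4) at_minus6 i * lam i = - ratr 6 * lam (inord 3).
  rewrite (bigD1 ord_max) //= big1 => [|i /negPf ne]; last by rewrite /at_minus6 ne mul0r.
  by rewrite addr0 /at_minus6 eqxx inord3.
move=> h; have s1 := spec_macmahon n (spec_mm_exponent 6); rewrite -h in s1.
have s2 := spec_sum_seq (fun pi => @spec_term n pi n7).
have := spec_uniq s2 s1; rewrite macmahon_ratr.
have -> : \sum_(pi <- solids n) ratr ((-1) ^+ e pi * value6 pi) =
    ratr (\sum_(pi <- solids n) (-1) ^+ e pi * value6 pi) :> K0.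
  by rewrite [RHS]ratrE rmorph_sum; apply: eq_bigr => pi _; rewrite ratrE.
by rewrite !ratrE => /fmorph_inj.
Qed.

(** [D x] is 0 if [x] has the expected sign and twice the positive number [value6 x] otherwise. By
    [signed_sum] and [sum_value6] these nonnegative terms have a sum at most 0, so all vanish. *)
Lemma sign_psize pi : solid pi -> (psize pi <= 6)%N -> (-1) ^+ e pi = (-1) ^+ psize pi :> rat.
Proof.
move=> s le6; set n := psize pi.
have n7 : (n < 7)%N by [].
pose D (x : array3) : rat := (1 - (-1) ^+ n * (-1) ^+ e x) * value6 x.
have D0 x : x \in solids n -> 0 <= D x.
  move=> xin; rewrite mulr_ge0 ?(ltW (solids_value6_gt0 n7 xin)) // subr_ge0.
  by rewrite -signr_odd -signr_addb; case: (_ (+) _).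
have : \sum_(x <- solids n) D x <= 0.
  rewrite /D; under eq_bigr do rewrite mulrBl mul1r -mulrA.
  by rewrite sumrB -mulr_sumr signed_sum // subr_le0 sum_value6.
have pin : pi \in solids n by apply/mem_solids.
rewrite (bigD1_seq pi) ?undup_uniq //= => hD.
have rest : 0 <= \sum_(x <- solids n | x != pi) D x.
  by rewrite big_seq_cond sumr_ge0 // => x /andP[/D0].
have : D pi <= 0 by apply: le_trans hD; rewrite lerDl.
rewrite /D pmulr_lle0 ?(solids_value6_gt0 n7 pin) // subr_le0 -/n -(signr_odd _ n).
by case: (odd n); case: (e pi).
Qed.
End Signs.

Lemma poly_spec_c_rhs d pi x om (e : bool) : (-1) ^+ e = (-1) ^+ psize pi :> rat -> 0 < om ->
  poly_specializes (Lw d pi x)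
    (map_poly ratr (((-1) ^+ e * om) *: \prod_(l < pi (0, 0, 0)%N) (d - l%:R))) ->
  prop_c d pi x.
Proof. by move=> es om0 h; exists om; split=> //; rewrite /c_rhs -es. Qed.

Theorem proposition1p11 :
  [/\
   (* (1) *)
   forall w : array3 -> K,
     (forall pi : array3, solid pi -> (psize pi <= 6)%N -> is_w pi (w pi)) ->
     sign_identity w ->
     forall pi : array3, solid pi -> (psize pi <= 6)%N ->
       [/\ prop_a 'X pi (w pi), prop_b 'X pi (w pi) & prop_c 'X pi (w pi)],
   (* (2) *)
   forall pi : array3, solid pi -> pi (0, 0, 0)%N = 1%N ->
     forall x : K, is_w pi x ->
       [/\ prop_a 1 pi x, prop_b 1 pi x
         & exists omega : rat,
             [/\ 0 < omega, `|omega| = 1 & c_sign 1 pi x omega]]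
   & (* (3) *)
   forall pi : array3, solid pi ->
     ((forall i j k : nat, ~ (i = 0%N /\ j = 0%N) -> pi (i, j, k) = 0%N) /\
        (psize pi <= 10)%N)
     \/ Zchar pi \in listed ->
     forall x : K, is_w pi x ->
       [/\ prop_a 'X pi x, prop_b 'X pi x & prop_c_sign 'X pi x]].
Proof.
split=> [w hw hs pi s le6|pi s h1 x wx|pi s hpi x wx].
(* One sign per partition is fixed for all $d$ at once, with an arbitrary value outside the range
   considered. *)
- have /choice[e he] : forall pi, exists e : bool, solid pi -> (psize pi <= 6)%N ->
      forall d : {poly rat}, poly_specializes (Lw d pi (w pi))
        (map_poly ratr (((-1) ^+ e * omega (boxes pi)) *: diag_prod d (boxes pi))).
    move=> p; have [[sp lp]|np] := pselect (solid p /\ (psize p <= 6)%N).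
      by have [e he] := Lw_specializes sp (hw p sp lp); exists e.
    by exists false => sp lp; case: np.
  have c0 : pi (1, 1, 1)%N = 0%N.
    by apply: (@solids_corner (psize pi)) => //; apply/mem_solids.
  have [a b _] := corner_props 'X s c0 (hw pi s le6); split=> //.
  apply: (poly_spec_c_rhs (sign_psize hs he s le6) (omega_gt0 (boxes pi))).
  by rewrite -diag_prod_corner //; apply: he.
- have [a b c] := height1_props s h1 wx; split=> //; exists 1.
  by rewrite normr1; split.
have c0 : pi (1, 1, 1)%N = 0%N.
  (* The position [(1, 1, 1)] is off the axis $i=j=0$, which settles the first family. *)
  by case: hpi => [[h _]|/(listed_corner s)//]; apply: h => -[].
have [a b c] := corner_props 'X s c0 wx; split=> //.
by exists (omega (boxes pi)); split=> //; apply: omega_gt0.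
Qed.
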